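(* Let $G=\mathrm{GL}_n$, $0<m<n$, $\mu=(1^{(m)},0^{(n-m)})$ and $b=\tau^m$. The following map is bijective: $$\flat\colon\Omega\backslash\mathcal A_{\mu,b}^{\mathrm{sm}}\to\{\nu\in W_0\mu\mid\nu\le\nu_b\},\qquad\Omega\lambda\mapsto\lambda^\flat.$$
   Context: Let $F$ be a non-archimedean local field with uniformizer $\varpi$, and take $G=\mathrm{GL}_n$ over $\mathcal O_F$ with diagonal torus $T$ and upper triangular Borel subgroup. $X_*(T)=\mathbb Z^n$, $W_0=\mathfrak S_n$ acting by $(w\lambda)(i)=\lambda(w^{-1}(i))$; roots $\chi_{ij}$ ($i\ne j$) with $\langle\chi_{ij},\lambda\rangle=\lambda(i)-\lambda(j)$, positive iff $i<j$. $\Pi=\{\chi_{i+1,i}\mid1\le i\le n-1\}\cup\{\chi_{1,n}\}$. The Iwahori-Weyl group is $\tilde W=\mathbb Z^n\rtimes\mathfrak S_n$, with $\varpi^\lambda u$ acting on $\mathbb Z^n$ by $v\mapsto uv+\lambda$. Let $c=(1\,2\,\cdots\,n)$, i.e. $c=s_1s_2\cdots s_{n-1}$ with $s_i=(i\ i+1)$, and $\tau=\varpi^{(1,0^{(n-1)})}c$; the group $\Omega$ of length $0$ elements is the infinite cyclic group generated by $\tau$. Here $b=\tau^m$, whose image in $W_0$ is $c^m$, and $\nu_b=(\tfrac mn,\ldots,\tfrac mn)$. The Frobenius acts trivially on $\mathbb Z^n$ and $\tilde W$. $x^{(k)}$ denotes $k$ repeated entries $x$. For $\nu,\nu'\in\mathbb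 Q^n$, $\nu\le\nu'$ means that $\nu'-\nu$ is a non-negative rational combination of positive coroots (so $\nu\le\nu_b$ iff all partial sums satisfy $\nu(1)+\cdots+\nu(k)\le km/n$, with equality for $k=n$). For $\lambda\in\mathbb Z^n$ and a root $\alpha$ put $\lambda_\alpha=\langle\alpha,\lambda\rangle$ if $\alpha$ is negative and $\lambda_\alpha=\langle\alpha,\lambda\rangle-1$ if $\alpha$ is positive. $\epsilon_\lambda\in W_0$ is the unique element with $\{\alpha\mid\lambda_\alpha\ge0\}=\epsilon_\lambda\Phi_+$. $\lambda^\natural=b\lambda-\lambda$ ($b$ acting as an affine transformation) and $\lambda^\flat=\epsilon_\lambda^{-1}(\lambda^\natural)$; $\lambda^\flat$ depends only on $\Omega\lambda$. $\lambda$ is small if for each $\alpha\in\Pi$ there is $\beta$ in the $c^m$-orbit of $\alpha$ with $\lambda_\beta\le0$. $\mathcal A_{\mu,b}^{\mathrm{sm}}=\{\lambda\in\mathbb Z^n\mid\lambda^\natural\in W_0\mu,\ \lambda\text{ small}\}$, which is $\Omega$-stable. *)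

(* Defs.v *)
From HB Require Import structures.
From mathcomp Require Import all_boot all_order all_algebra all_fingroup.
From mathcomp Require Import boolp classical_sets functions.

Set Implicit Arguments.
Unset Strict Implicit.
Unset Printing Implicit Defensive.

Import Order.TTheory GRing.Theory Num.Theory.
Local Open Scope ring_scope.

(* Indices are 0-based: the index i of the mathematical text, 1 <= i <= n, is  *)
(* the element i - 1 of 'I_n.                                                 *)
Notation cochar n := {ffun 'I_n -> int}.

(* Permutations multiply left to right in MathComp: (s * t)%g i = t (s i).    *)
Definition perm_act (n : nat) (V : zmodType) (w : 'S_n)
    (l : {ffun 'I_n -> V}) : {ffun 'I_n -> V} :=
  [ffun i => l ((w^-1)%g i)].

Lemma perm_act1 (n : nat) (V : zmodType) (l : {ffun 'I_n -> V}) :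
  perm_act 1%g l = l.
Proof. by apply/ffunP=> i; rewrite ffunE invg1 perm1. Qed.

Lemma perm_actM (n : nat) (V : zmodType) (u v : 'S_n) (l : {ffun 'I_n -> V}) :
  perm_act (v * u)%g l = perm_act u (perm_act v l).
Proof. by apply/ffunP=> i; rewrite !ffunE invMg permM. Qed.

Lemma perm_actD (n : nat) (V : zmodType) (u : 'S_n)
    (k l : {ffun 'I_n -> V}) :
  perm_act u (k + l) = perm_act u k + perm_act u l.
Proof. by apply/ffunP=> i; rewrite !ffunE. Qed.

Lemma perm_actN (n : nat) (V : zmodType) (u : 'S_n) (l : {ffun 'I_n -> V}) :
  perm_act u (- l) = - perm_act u l.
Proof. by apply/ffunP=> i; rewrite !ffunE. Qed.

(* IW l u is the element \varpi^l u of the Iwahori-Weyl group Z^n ><| S_n.    *)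
Record iwahori_weyl (n : nat) := IW { iw_trans : cochar n; iw_fin : 'S_n }.

Definition iw_act (n : nat) (x : iwahori_weyl n) (v : cochar n) : cochar n :=
  perm_act (iw_fin x) v + iw_trans x.

Section IwahoriWeylGroup.
Variable n : nat.
Implicit Types x y : iwahori_weyl n.

Definition iw_pair x : cochar n * 'S_n := (iw_trans x, iw_fin x).
Definition iw_of_pair (p : cochar n * 'S_n) : iwahori_weyl n := IW p.1 p.2.
Lemma iw_pairK : cancel iw_pair iw_of_pair. Proof. by case. Qed.

HB.instance Definition _ :=
  Choice.copy (iwahori_weyl n) (can_type iw_pairK).

(* (\varpi^k u) (\varpi^l v) = \varpi^(k + u l) (u o v)                       *)
Definition iw_mul x y : iwahori_weyl n :=
  IW (iw_trans x + perm_act (iw_fin x) (iw_trans y)) (iw_fin y * iw_fin x)%g.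
Definition iw_one : iwahori_weyl n := IW 0 1%g.
Definition iw_inv x : iwahori_weyl n :=
  IW (- perm_act (iw_fin x)^-1%g (iw_trans x)) (iw_fin x)^-1%g.

Lemma iw_mulA : associative iw_mul.
Proof.
case=> k u [l v] [p w]; rewrite /iw_mul /=; congr IW; last by rewrite mulgA.
by rewrite perm_actD perm_actM addrA.
Qed.

Lemma iw_mul1 : left_id iw_one iw_mul.
Proof. by case=> k u; rewrite /iw_mul /= perm_act1 add0r mulg1. Qed.

Lemma iw_mulr1 : right_id iw_one iw_mul.
Proof.
case=> k u; rewrite /iw_mul /= mul1g; congr IW.
by apply/ffunP=> i; rewrite !ffunE addr0.
Qed.

Lemma iw_mulV : left_inverse iw_one iw_inv iw_mul.
Proof. by case=> k u; rewrite /iw_mul /= addNr mulgV. Qed.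

Lemma iw_mulrV : right_inverse iw_one iw_inv iw_mul.
Proof.
case=> k u; rewrite /iw_mul /= mulVg perm_actN -perm_actM mulVg perm_act1.
by rewrite subrr.
Qed.

HB.instance Definition _ := isGroup.Build (iwahori_weyl n)
  iw_mulA iw_mul1 iw_mulr1 iw_mulV iw_mulrV.

End IwahoriWeylGroup.

Lemma iw_actM (n : nat) (x y : iwahori_weyl n) (v : cochar n) :
  iw_act (x * y)%g v = iw_act x (iw_act y v).
Proof.
by case: x y => k u [l w]; rewrite /iw_act /= perm_actM perm_actD addrAC addrA.
Qed.

(* c = (1 2 ... n), i.e. i |-> i + 1 modulo n.                                *)
Definition cyc (n : nat) : 'S_n := perm (@ordS_inj n).

Definition tau (n : nat) : iwahori_weyl n :=
  IW [ffun i : 'I_n => (i == 0%N :> nat)%:R] (cyc n).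

Definition Omega (n : nat) : set (iwahori_weyl n) :=
  [set w | exists k : nat, w = (tau n ^+ k)%g \/ w = (tau n ^- k)%g]%classic.
Arguments Omega n : clear implicits.

Definition b_tau (n m : nat) : iwahori_weyl n := (tau n ^+ m)%g.

Lemma iw_fin_b (n m : nat) : iw_fin (b_tau n m) = (cyc n ^+ m)%g.
Proof.
rewrite /b_tau; elim: m => [|m IHm]; first by rewrite !expg0.
by rewrite expgS expgSr -IHm.
Qed.

(* The root chi_ij is the pair (i, j) with i != j.                            *)
Definition Phi (n : nat) : {set 'I_n * 'I_n} := [set a : 'I_n * 'I_n | a.1 != a.2].

Definition Phi_pos (n : nat) : {set 'I_n * 'I_n} := [set a : 'I_n * 'I_n | (a.1 < a.2)%N].

Definition root_act (n : nat) (w : 'S_n) (a : 'I_n * 'I_n) : 'I_n * 'I_n :=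
  (w a.1, w a.2).

Definition pairing (n : nat) (a : 'I_n * 'I_n) (l : cochar n) : int :=
  l a.1 - l a.2.

(* \Pi = {chi_(i+1, i)} u {chi_(1, n)}                                        *)
Definition Pi (n : nat) : {set 'I_n * 'I_n} :=
  [set a in Phi n | (a.1 == a.2.+1 :> nat) ||
                    (a.1 == 0%N :> nat) && (a.2 == n.-1 :> nat)].

Definition root_val (n : nat) (l : cochar n) (a : 'I_n * 'I_n) : int :=
  if a \in Phi_pos n then pairing a l - 1 else pairing a l.

Definition is_epsilon (n : nat) (l : cochar n) (w : 'S_n) : bool :=
  [set a in Phi n | 0 <= root_val l a] == [set root_act w a | a in Phi_pos n].

(* The default value 1 is never used, see epsilonP below.                     *)
Definition epsilon (n : nat) (l : cochar n) : 'S_n :=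
  odflt 1%g [pick w | is_epsilon l w].

Definition natural (n m : nat) (l : cochar n) : cochar n :=
  iw_act (b_tau n m) l - l.

Definition flat (n m : nat) (l : cochar n) : cochar n :=
  perm_act (epsilon l)^-1%g (natural m l).

Definition small (n m : nat) (l : cochar n) : Prop :=
  forall a, a \in Pi n ->
  exists k : nat, root_val l (root_act ((cyc n ^+ m) ^+ k)%g a) <= 0.

Definition W0_orbit (n : nat) (l : cochar n) : set (cochar n) :=
  [set perm_act w l | w in [set: 'S_n]%classic]%classic.

(* mu = (1^(m), 0^(n - m))                                                    *)
Definition mu (n m : nat) : cochar n := [ffun i : 'I_n => (i < m)%N%:R].

Definition A_sm (n m : nat) : set (cochar n) :=
  [set l | W0_orbit (mu n m) (natural m l) /\ small m l]%classic.
Arguments A_sm n m : clear implicits.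

Definition Omega_orbit (n : nat) (l : cochar n) : set (cochar n) :=
  [set iw_act w l | w in Omega n]%classic.

Definition Omega_quotient (n : nat) (A : set (cochar n)) :
    set (set (cochar n)) :=
  [set Omega_orbit l | l in A]%classic.

Definition coroot (n : nat) (a : 'I_n * 'I_n) : {ffun 'I_n -> rat} :=
  [ffun i => (i == a.1)%:R - (i == a.2)%:R].

Definition dom_le (n : nat) (nu nu' : {ffun 'I_n -> rat}) : Prop :=
  exists2 q : 'I_n * 'I_n -> rat,
    forall a, a \in Phi_pos n -> 0 <= q a &
    forall i, nu' i - nu i = \sum_(a in Phi_pos n) q a * coroot a i.

Definition cochar_rat (n : nat) (l : cochar n) : {ffun 'I_n -> rat} :=
  [ffun i => (l i)%:~R].

Definition nu_b (n m : nat) : {ffun 'I_n -> rat} := [ffun=> m%:R / n%:R].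

Definition W0mu_le_nu_b (n m : nat) : set (cochar n) :=
  [set nu | W0_orbit (mu n m) nu /\ dom_le (cochar_rat nu) (nu_b n m)]%classic.
Arguments W0mu_le_nu_b n m : clear implicits.

Section Epsilon.
Variables (n : nat) (l : cochar n).

Definition before (i j : 'I_n) : bool :=
  (l j < l i) || (l i == l j) && (j < i)%N.

Lemma root_val_ge0 (a : 'I_n * 'I_n) :
  (a \in Phi n) && (0 <= root_val l a) = before a.1 a.2.
Proof.
case: a => i j; rewrite /root_val /pairing /before !inE /=.
have [->|nij] /= := eqVneq i j; first by rewrite ltxx ltnn andbF.
case: ifP => ij.
  rewrite subr_ge0 -[1 <= _]/(0 + 1 <= _) lezD1 subr_gt0.
  by rewrite [(j < i)%N]ltnNge (ltnW ij) andbF orbF.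
have -> : (j < i)%N.
  by rewrite ltn_neqAle leqNgt ij andbT; apply: contra nij => /eqP/val_inj ->.
by rewrite subr_ge0 andbT le_eqVlt orbC eq_sym.
Qed.

Lemma before_irr i : before i i = false.
Proof. by rewrite /before ltxx ltnn andbF. Qed.

Lemma before_trans : transitive before.
Proof.
move=> j i k; rewrite /before.
move=> /orP[lji|/andP[/eqP-> ji]] /orP[lkj|/andP[/eqP<- kj]].
- by rewrite (lt_trans lkj lji).
- by rewrite lji.
- by rewrite lkj.
- by rewrite eqxx (ltn_trans kj ji) orbT.
Qed.

Lemma before_total i j : i != j -> before i j || before j i.
Proof.
move=> nij; rewrite /before; case: (ltgtP (l i) (l j)) => //= _.
by rewrite orbC -neq_ltn.
Qed.

Lemma is_epsilonP (w : 'S_n) :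
  reflect (forall i j, before (w i) (w j) = (i < j)%N) (is_epsilon l w).
Proof.
apply: (iffP eqP) => [E i j|E]; last first.
  apply/setP=> -[i j]; rewrite inE root_val_ge0 /= -[i](permKV w) -[j](permKV w).
  rewrite E; apply/idP/imsetP => [ij|[[p q]]].
    by exists ((w^-1)%g i, (w^-1)%g j); rewrite ?inE.
  by rewrite inE /root_act /= => pq [/perm_inj-> /perm_inj->].
move/setP: E => /(_ (w i, w j)); rewrite inE root_val_ge0 /= => ->.
apply/imsetP/idP => [[[p q]]|ij]; last by exists (i, j); rewrite ?inE.
by rewrite inE /root_act /= => pq [/perm_inj-> /perm_inj->].
Qed.

Lemma is_epsilon_exists : exists w : 'S_n, is_epsilon l w.
Proof.
pose leb i j := (i == j) || before i j.
have leb_total : total leb.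
  move=> i j; rewrite /leb (eq_sym j i); case: eqVneq => //=.
  exact: before_total.
have leb_trans : transitive leb.
  move=> j i k /orP[/eqP->//|ij] /orP[/eqP<-|jk]; rewrite /leb.
    by rewrite ij orbT.
  by rewrite (before_trans ij jk) orbT.
pose s := sort leb (enum 'I_n).
have szs : size s = n by rewrite size_sort size_enum_ord.
have us : uniq s by rewrite sort_uniq enum_uniq.
pose f (i : 'I_n) : 'I_n := nth i s i.
have f_nth (i0 i : 'I_n) : f i = nth i0 s i.
  by apply: set_nth_default; rewrite szs.
have f_inj : injective f.
  move=> i j; rewrite (f_nth i i) (f_nth i j) => /eqP.
  by rewrite nth_uniq ?szs // => /eqP/val_inj.
have f_lt (i j : 'I_n) : (i < j)%N -> before (f i) (f j).
  move=> ij; have /(sorted_ltn_nth leb_trans) : sorted leb s by exact: sort_sorted.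
  move=> /(_ i i j); rewrite !inE !szs !ltn_ord => /(_ isT isT ij).
  rewrite -!f_nth /leb => /orP[/eqP/f_inj E|//].
  by rewrite E ltnn in ij.
exists (perm f_inj); apply/is_epsilonP => i j; rewrite !permE.
case: (ltngtP i j) => [ij|ji|/val_inj->]; last exact: before_irr.
  exact: f_lt.
apply: contraTF (f_lt _ _ ji) => B; apply/negP => B'.
by move: (before_trans B B'); rewrite before_irr.
Qed.

Lemma is_epsilon_unique (w w' : 'S_n) :
  is_epsilon l w -> is_epsilon l w' -> w = w'.
Proof.
suff rank (v : 'S_n) i : is_epsilon l v ->
    #|[set j | before j (v i)]| = i :> nat.
  move=> ew ew'; apply/permP => i.
  have := rank _ i ew; have := rank _ ((w'^-1)%g (w i)) ew'.
  by rewrite permKV => -> /val_inj wi; rewrite -{2}wi permKV.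
move=> /is_epsilonP E.
have -> : [set j | before j (v i)] = [set v j | j in [set j : 'I_n | (j < i)%N]].
  apply/setP => j; rewrite inE -[j](permKV v) E mem_imset; last exact: perm_inj.
  by rewrite inE.
rewrite card_imset; last exact: perm_inj.
rewrite -sum1dep_card.
rewrite -(big_ord_widen n (fun=> 1%N)) ?sum1_card ?card_ord; last exact: ltnW.
by [].
Qed.

Lemma epsilonP : is_epsilon l (epsilon l).
Proof.
rewrite /epsilon; case: pickP => [//|E].
by have [w] := is_epsilon_exists; rewrite E.
Qed.

End Epsilon.

(* Main.v *)
Require Import Defs.
From mathcomp Require Import all_boot all_order all_algebra all_fingroup.
From mathcomp Require Import boolp classical_sets functions.
From mathcomp Require Import zify ring.

(* Extend [x i = i + n * l i] to an [n]-periodic function on the integers with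
   [x z] congruent to [z] modulo [n]. Then [tau] adds 1 to the set of values of
   [x], and [epsilon l] sorts these values decreasingly into [X 0 > X 1 > ...].
   With [nu = flat m l], [X (p k) = X k + n * nu k - m] for a permutation [p];
   since the first [j] values are the largest ones, the partial sums of
   [n * nu k - m] are at most 0, which is [nu <= nu_b].

   Injectivity: if [l] and [l'] have the same image, the equality case of the
   rearrangement inequality shows that they have the same [p], so that matching
   the sorted values gives a bijection [f] of the integers commuting with the
   translations by [m] and [n]. The two ends of an inversion of [f] never meet
   under translation by [m]; smallness of [l] fixes which one is higher, and
   smallness of [l'] gives the opposite answer. So [f] is a translation.

   Surjectivity: adding [n * nu k - m] and sorting does not increase Euclidean
   distances. A starting point of minimal displacement is therefore sorted by
   one and the same permutation forever; dominance makes its orbit periodic, and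
   the sum over the orbit solves a rescaled equation. Counting points of the
   periodic set spanned by a generic solution rescales it back. Among the
   solutions, one of minimal Euclidean norm is small. *)

Set Implicit Arguments.
Unset Strict Implicit.
Unset Printing Implicit Defensive.

Import Order.TTheory GRing.Theory Num.Theory.
Local Open Scope ring_scope.

(** * Rearrangement *)


(** Abel summation: a partial sum is at most 0, so lowering its coefficient from [c N] to [c N.+1]
    only raises the product. *)
Lemma abel_nat (c s : nat -> int) (N : nat) :
  (forall i, (i < N)%N -> c i.+1 <= c i) ->
  (forall j, (j <= N)%N -> \sum_(i < j) s i <= 0) ->
  \sum_(i < N.+1) c i * s i <= c N * \sum_(i < N.+1) s i.
Proof.
elim: N => [|N IH] hc hs; first by rewrite !big_ord_recr !big_ord0 /= !add0r.
rewrite big_ord_recr /= [X in _ <= _ * X]big_ord_recr /= mulrDr lerD2r.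
apply: le_trans (IH _ _) _ => [i iN|j jN|]; first exact/hc/ltnW.
  exact/hs/leqW.
apply: ler_wnM2r; last exact: hc.
exact: hs.
Qed.

Definition sdec (n : nat) (x : 'I_n -> int) := forall i j : 'I_n, (i < j)%N -> x j < x i.
Definition wdec (n : nat) (x : 'I_n -> int) := forall i j : 'I_n, (i < j)%N -> x j <= x i.
Definition psum (n : nat) (s : 'I_n -> int) (j : nat) :=
  \sum_(i < n | (i < j)%N) s i.

Section Sorted.
Variable n : nat.
Implicit Types (x y c s : 'I_n -> int) (p q : 'S_n).

Lemma sdecW x : sdec x -> wdec x.
Proof. by move=> h i j /h /ltW. Qed.

Lemma sdec_lt x : sdec x -> forall i j, (x j < x i) = (i < j)%N.
Proof.
move=> hx i j; case: (ltngtP i j) => [/hx->//|/hx ji|/val_inj->]; last by rewrite ltxx.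
by apply/negbTE; rewrite -leNgt ltW.
Qed.

Lemma sdec_inj x : sdec x -> injective x.
Proof.
move=> hx i j e; apply: val_inj; case: (ltngtP i j) => // /hx; by rewrite e ltxx.
Qed.

Lemma abel_le c s : wdec c -> (forall j, psum s j <= 0) -> \sum_i s i = 0 ->
  \sum_i c i * s i <= 0.
Proof.
case: n c s => [|N] c s hc hs h0; first by rewrite big_ord0.
pose c' i := c (inord i); pose s' i := s (inord i).
have E i : c i * s i = c' i * s' i by rewrite /c' /s' !inord_val.
rewrite (eq_bigr _ (fun i _ => E i)).
have S0 : \sum_(i < N.+1) s' i = 0.
  by rewrite -[RHS]h0; apply: eq_bigr => i _; rewrite /s' inord_val.
apply: le_trans (abel_nat (c := c') (s := s') _ _) _ => [i iN|j jN|].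
- by apply: hc; rewrite !inordK ?ltnS // ltnW.
- rewrite (big_ord_widen N.+1 s') ?(leqW jN) //.
  apply: le_trans (hs j); rewrite le_eqVlt; apply/orP; left; apply/eqP.
  by apply: eq_bigr => i _; rewrite /s' inord_val.
- by rewrite S0 mulr0.
Qed.

Lemma sum_permute x p : \sum_i x (p i) = \sum_i x i.
Proof. by rewrite [RHS](reindex_inj (@perm_inj _ p)). Qed.

(** The first [j] entries of a decreasing sequence are its largest, so no other [j] entries have a
    larger sum. *)
Lemma psum_perm_le x p j : wdec x -> psum (fun i => x (p i) - x i) j <= 0.
Proof.
move=> hx; rewrite /psum sumrB.
have [jn|nj] := leqP n j; last first.
  have E (F : 'I_n -> int) :
      \sum_(i < n | (i < j)%N) F i = \sum_(i < n) (i < j)%N%:R * F i.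
    by rewrite big_mkcond; apply: eq_bigr => i _; case: ifP; rewrite ?mul1r ?mul0r.
  have C : \sum_(i < n) ((p^-1)%g i < j)%N%:R = \sum_(i < n) (i < j)%N%:R :> int.
    exact: (sum_permute (fun i : 'I_n => (i < j)%N%:R) (p^-1)%g).
  (* Subtracting the threshold [t] is free because both indicators have the same total by [C];
     afterwards every summand is at most 0. *)
  rewrite !{}E; pose t := x (Ordinal nj).
  rewrite -[X in X - _](sum_permute (fun i => (i < j)%N%:R * x (p i)) (p^-1)%g).
  under eq_bigr do rewrite permKV.
  rewrite -sumrB.
  suff : \sum_(i < n) (((p^-1)%g i < j)%N%:R * (x i - t) - (i < j)%N%:R * (x i - t)) <= 0.
    have H (F : 'I_n -> int) :
        \sum_i F i * (x i - t) = \sum_i F i * x i - (\sum_i F i) * t.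
      by rewrite mulr_suml -sumrB; apply: eq_bigr => i _; rewrite mulrBr.
    by rewrite !sumrB !H C opprB addrA subrK.
  apply: sumr_le0 => i _; rewrite -mulrBl.
  have [ij|] := ltnP i j.
    have := hx i (Ordinal nj) ij; rewrite -/t.
    case: ltnP => _ /=; lia.
  rewrite leq_eqVlt => /orP[/eqP e|ji].
    have -> : i = Ordinal nj by apply: val_inj.
    by rewrite subrr mulr0.
  have := hx (Ordinal nj) i ji; rewrite -/t.
  case: ltnP => _ /=; lia.
have J (i : 'I_n) : (i < j)%N by exact: leq_trans (ltn_ord i) jn.
under eq_bigl do rewrite J.
under [X in _ - X]eq_bigl do rewrite J.
by rewrite sum_permute subrr.
Qed.

Lemma rearrangement_le x y p : wdec x -> wdec y ->
  \sum_i x (p i) * y i <= \sum_i x i * y i.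
Proof.
move=> hx hy; rewrite -subr_le0 -sumrB.
under eq_bigr do rewrite -mulrBl mulrC.
apply: abel_le => // [j|]; first exact: psum_perm_le.
by rewrite sumrB sum_permute subrr.
Qed.

(** Strict decrease of [y] leaves room to perturb it, which forces all partial sums of
    [x (p i) - x i] to vanish. *)
Lemma rearrangement_eq x y p : sdec x -> sdec y ->
  \sum_i x (p i) * y i = \sum_i x i * y i -> p = 1%g.
Proof.
move=> hx hy E; pose s i : int := x (p i) - x i.
have sy : \sum_i y i * s i = 0.
  under eq_bigr do rewrite mulrC mulrBl.
  by rewrite sumrB E subrr.
have s0 : \sum_i s i = 0 by rewrite sumrB sum_permute subrr.
(* [y] minus the indicator of [i < j] is still weakly decreasing. *)
have P0 j : psum s j = 0.
  apply/eqP; rewrite eq_le (psum_perm_le _ _ (sdecW hx)) /=.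
  have : \sum_i (y i - (i < j)%N%:R) * s i <= 0.
    apply: abel_le => // [i k ik|k]; last exact/psum_perm_le/sdecW.
    have := hy i k ik; case: (ltnP i j); case: (ltnP k j) => /=; lia.
  under eq_bigr do rewrite mulrBl.
  rewrite sumrB sy sub0r oppr_le0.
  suff -> : psum s j = \sum_(i < n) (i < j)%N%:R * s i by [].
  rewrite /psum big_mkcond.
  by apply: eq_bigr => i _; case: ifP; rewrite ?mul1r ?mul0r.
apply/permP => i; rewrite perm1; apply: (sdec_inj hx); apply/eqP.
rewrite -subr_eq0 -/(s i); have := P0 i.+1; rewrite /psum (bigD1 i) //=.
have -> : \sum_(k < n | (k < i.+1)%N && (k != i)) s k = psum s i.
  by apply: eq_bigl => k; rewrite ltnS [(k < i)%N]ltn_neqAle andbC.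
by rewrite P0 addr0 => ->.
Qed.

Definition step s p x x' := forall k, x' (p k) = x k + s k.

(** The common [s] cancels in [x k - y k] and permuting keeps norms, so only cross terms, a
    rearrangement defect, remain. *)
Lemma step_dist s p q x x' y y' : step s p x x' -> step s q y y' ->
  \sum_k (x k - y k) ^+ 2 - \sum_k (x' k - y' k) ^+ 2 =
  (\sum_k x' k * y' k - \sum_k x' ((q^-1 * p)%g k) * y' k) *+ 2.
Proof.
move=> hx hy.
have -> : \sum_k (x k - y k) ^+ 2 = \sum_k (x' (p k) - y' (q k)) ^+ 2.
  by apply: eq_bigr => k _; rewrite hx hy; ring.
have sq (u v : 'I_n -> int) : \sum_k (u k - v k) ^+ 2 =
    \sum_k u k ^+ 2 + \sum_k v k ^+ 2 - (\sum_k u k * v k) *+ 2.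
  rewrite -sumrMnl -big_split -sumrB /=; apply: eq_bigr => k _; ring.
rewrite !sq (sum_permute (fun k => x' k ^+ 2)) (sum_permute (fun k => y' k ^+ 2)).
have -> : \sum_k x' (p k) * y' (q k) = \sum_k x' ((q^-1 * p)%g k) * y' k.
  rewrite -(sum_permute (fun k => x' ((q^-1 * p)%g k) * y' k) q).
  by apply: eq_bigr => k _; rewrite permM permK.
ring.
Qed.

Lemma step_dist_le s p q x x' y y' : step s p x x' -> step s q y y' ->
  sdec x' -> sdec y' -> \sum_k (x' k - y' k) ^+ 2 <= \sum_k (x k - y k) ^+ 2.
Proof.
move=> hx hy dx dy; rewrite -subr_ge0 (step_dist hx hy) mulrn_wge0 // subr_ge0.
by apply: rearrangement_le; exact: sdecW.
Qed.

Lemma step_dist_eq s p q x x' y y' : step s p x x' -> step s q y y' ->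
  sdec x' -> sdec y' -> \sum_k (x' k - y' k) ^+ 2 = \sum_k (x k - y k) ^+ 2 ->
  p = q.
Proof.
move=> hx hy dx dy E; have := step_dist hx hy; rewrite E subrr => /esym/eqP.
rewrite mulrn_eq0 /= subr_eq0 => /eqP/esym/(rearrangement_eq dx dy) => e.
by rewrite -[p](mulKVg q) e mulg1.
Qed.

Lemma sort_exists (g : 'I_n -> int) : injective g ->
  exists p x, sdec x /\ forall k, x (p k) = g k.
Proof.
move=> gi; have [w /is_epsilonP E] := is_epsilon_exists [ffun i => g i].
exists (w^-1)%g, (fun i => g (w i)); split=> [i j ij|k]; last by rewrite permKV.
have := E i j; rewrite ij /before !ffunE => /orP[//|/andP[/eqP/gi/perm_inj e]].
by move: ij; rewrite e ltnn.
Qed.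

End Sorted.

(** * Orbits of the sorting dynamics *)


(** Discrete intermediate values: rising by at most 1, an integer sequence cannot jump over 0. *)
Lemma int_sign_nat (h : nat -> int) : (forall i, h i.+1 <= h i + 1) ->
  (forall i, h i != 0) -> forall k, h k < 0 -> forall i, (k <= i)%N -> h i < 0.
Proof.
move=> hs h0 k hk; elim=> [|i IH]; first by rewrite leqn0 => /eqP<-.
rewrite leq_eqVlt => /orP[/eqP<-//|ki]; move: (hs i) (IH ki) (h0 i.+1); lia.
Qed.

Section Existence.
Variables (n : nat) (s : 'I_n -> int).
Hypothesis s_mod : forall k l, (n %| s k - s l)%Z.
Implicit Types (x : 'I_n -> int) (p : 'S_n).

Definition distinct_mod (d : int) x := forall k l, (d %| x k - x l)%Z -> k = l.

Lemma step_exists x : distinct_mod n x ->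
  exists p x', [/\ sdec x', distinct_mod n x' & step s p x x'].
Proof.
move=> dx; have [|p [x' [hx' E]]] := @sort_exists n (fun k => x k + s k).
  move=> k l e; apply: dx; have -> : x k - x l = s l - s k by lia.
  exact: s_mod.
exists p, x'; split=> // k l; rewrite -[k](permKV p) -[l](permKV p) !E.
move=> h; congr (p _); apply: dx; move: h; set k' := _ k; set l' := _ l.
have -> : x k' + s k' - (x l' + s l') = (x k' - x l') + (s k' - s l') by lia.
by rewrite rpredDr // s_mod.
Qed.

Definition shift p x (j : 'I_n) : int := x ((p^-1)%g j) + s ((p^-1)%g j).

Lemma step_shift p x : step s p x (shift p x).
Proof. by move=> k; rewrite /shift permK. Qed.

(* A triple [x, x', p] minimizing the displacement: sorting does not increase
   distances, and keeps them only if the sorting permutation does not change. *)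
Lemma stationary_perm : exists p x, forall t, sdec (iter t (shift p) x).
Proof.
pose Q (x : 'I_n -> int) p x' :=
  [/\ sdec x, distinct_mod n x, sdec x', distinct_mod n x' & step s p x x'].
pose D (x x' : 'I_n -> int) := \sum_k (x' k - x k) ^+ 2.
have D0 x x' : 0 <= D x x' by apply: sumr_ge0 => k _; exact: sqr_ge0.
pose A e := `[< exists x p x', Q x p x' /\ D x x' = e%:Z >].
have exA : exists e, A e.
  pose x0 (k : 'I_n) : int := - (k%:Z).
  have s0 : sdec x0 by move=> i j; rewrite /x0; lia.
  have d0 : distinct_mod n x0.
    move=> k l; rewrite /x0 => /dvdzP [q e]; apply: val_inj => /=.
    have := ltn_ord k; have := ltn_ord l; move: (k : nat) (l : nat) e => a b e.
    move=> bn an; have [q0|[q0|q0]] : q = 0 \/ 0 < q \/ q < 0 by lia.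
    - by rewrite q0 mul0r in e; lia.
    - by have := ler_wpM2r (ler0n int n) (q0 : 1 <= q); rewrite natz; lia.
    - have q1 : q <= -1 by lia.
      by have := ler_wpM2r (ler0n int n) q1; rewrite natz; lia.
  have [p [x' [h1 h2 h3]]] := step_exists d0.
  exists `|D x0 x'|%N; apply/asboolP; exists x0, p, x'; split => //.
  by rewrite gez0_abs.
case: (ex_minnP exA) => e /asboolP[x [p [x' [qx De]]]] emin.
have key y y' : Q y p y' -> D y y' = e%:Z ->
    Q y' p (shift p y') /\ D y' (shift p y') = e%:Z.
  case=> [s1 d1 s2 d2 st] Dy.
  have [q [y'' [s3 d3 st']]] := step_exists d2.
  (* Non-expansion is applied to [y] and its own successor [y']: the displacement cannot grow, and
     minimality of [e] forbids a drop. *)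
  have le1 : D y' y'' <= D y y' by exact: (step_dist_le st' st).
  have le2 : D y y' <= D y' y''.
    rewrite Dy -[leRHS]gez0_abs // lez_nat; apply: emin.
    by apply/asboolP; exists y', q, y''; split => //; rewrite gez0_abs.
  have E : D y' y'' = D y y' by apply/eqP; rewrite eq_le le1.
  have pq := step_dist_eq st' st s3 s2 E.
  have -> : shift p y' = y''.
    apply: funext => j; rewrite -[j](permKV p) step_shift.
    by rewrite -pq st'.
  by rewrite E; split => //; split => //; rewrite -pq.
exists p, x; suff H t : exists y, iter t (shift p) x = y /\
    exists y', Q y p y' /\ D y y' = e%:Z /\ y' = shift p y.
  by move=> t; have [y [-> [y' [[]]]]] := H t.
have x'E : x' = shift p x.
  case: qx => _ _ _ _ st; apply: funext => j.
  by rewrite -[j](permKV p) step_shift st.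
elim: t => [|t [y [ty [y' [qy [Dy ye]]]]]]; first by exists x; split=> //; exists x'.
have [q1 q2] := key _ _ qy Dy.
exists y'; split; first by rewrite iterS ty ye.
by exists (shift p y'); split.
Qed.

Hypothesis s_dom : forall j, psum s j <= 0.
Hypothesis s_sum : \sum_k s k = 0.

Lemma iter_shift p x t k :
  iter t (shift p) x ((p ^+ t)%g k) = x k + \sum_(i < t) s ((p ^+ i)%g k).
Proof.
elim: t => [|t IH]; first by rewrite big_ord0 addr0 expg0 perm1.
by rewrite iterS expgSr permM step_shift IH big_ord_recr /= addrA.
Qed.

Lemma sum_cyclic (f : nat -> int) (L : nat) : f L = f 0%N ->
  \sum_(t < L) f t.+1 = \sum_(t < L) f t.
Proof.
move=> e; apply: (addrI (f 0%N)); rewrite -(big_ord_recl L (fun i => f i)) /=.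
by rewrite big_ord_recr /= e addrC.
Qed.

(** [c k] is the drift over [L] steps, [L] being the order of [p]. Permanent sortedness makes [c]
    decreasing, so its pairing with [s] is at most 0; but [L] times this pairing is the squared norm
    of [c]. Hence [c = 0], the orbit closes after [L] steps, and its sum is [z]. *)
Lemma scaled_fixed_point : exists p z (L : nat),
  [/\ (0 < L)%N, sdec z & forall k, z (p k) = z k + L%:Z * s k].
Proof.
have [p [x hx]] := stationary_perm.
pose L := #[p]%g; have L0 : (0 < L)%N by exact: order_gt0.
have pL : (p ^+ L = 1)%g by exact: expg_order.
pose c k := \sum_(i < L) s ((p ^+ i)%g k).
have iterL y k : iter L (shift p) y k = y k + c k.
  by have := iter_shift p y L k; rewrite pL perm1.
have iterLq q k : iter (q * L) (shift p) x k = x k + q%:Z * c k.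
  elim: q k => [|q IH] k; first by rewrite mul0n mul0r addr0.
  by rewrite mulSn iterD iterL IH -addrA intS mulrDl mul1r [c k + _]addrC.
have cp k : c (p k) = c k.
  rewrite /c -(sum_cyclic (f := fun i => s ((p ^+ i)%g k))) ?pL ?expg0 //.
  by apply: eq_bigr => i _; rewrite expgS permM.
have cpi k i : c ((p ^+ i)%g k) = c k.
  by elim: i => [|i IH]; rewrite ?expg0 ?perm1 // expgSr permM cp.
have c_dec : wdec c.
  move=> k l kl; rewrite leNgt; apply/negP => ckl.
  (* The number of rounds exceeds the initial gap, so a larger drift of [l] would have overtaken
     [k]. *)
  have := hx ((`|x k - x l| + 1)%N * L)%N k l kl; rewrite !iterLq.
  move: (x k) (x l) (c k) (c l) ckl => a b c1 c2 h.
  set q := (`|a - b| + 1)%N%:Z; have : q > a - b by lia.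
  by nia.
have cs : L%:Z * (\sum_k c k * s k) = \sum_k c k ^+ 2.
  have -> : \sum_k c k ^+ 2 = \sum_k \sum_(i < L) c k * s ((p ^+ i)%g k).
    by apply: eq_bigr => k _; rewrite -mulr_sumr.
  rewrite exchange_big /= -[L in LHS]card_ord -natz mulr_natl -sumr_const.
  apply: eq_bigr => i _; rewrite -(sum_permute (fun k => c k * s k) (p ^+ i)%g).
  by apply: eq_bigr => k _; rewrite cpi.
have c0 k : c k = 0.
  have : \sum_k c k ^+ 2 <= 0.
    rewrite -cs; have := abel_le c_dec s_dom s_sum.
    by move=> h; apply: mulr_ge0_le0.
  move=> h; have /eqP : \sum_k c k ^+ 2 = 0.
    by apply/eqP; rewrite eq_le h sumr_ge0 // => i _; exact: sqr_ge0.
  rewrite psumr_eq0 => [/allP/(_ k)|i _]; last exact: sqr_ge0.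
  by rewrite mem_index_enum sqrf_eq0 => /(_ isT)/eqP.
exists p, (fun k => \sum_(t < L) iter t (shift p) x k), L; split=> // [i j ij|k].
  move: L0 {iterL iterLq cp cpi c_dec cs c0 pL} c; case: L => // M _ _.
  rewrite !big_ord_recr /=; apply: ler_ltD; last exact: hx.
  by apply: ler_sum => t _; apply/ltW/hx.
rewrite -(sum_cyclic (f := fun t => iter t (shift p) x (p k))); last first.
  by rewrite /= iterL c0 addr0.
under eq_bigr do rewrite /= step_shift.
by rewrite big_split /= sumr_const card_ord -[_ *+ L]mulr_natl natz.
Qed.

End Existence.

(** * From rescaled to integral solutions *)


Section Untangle.
Variables (n : nat) (m : nat) (nu : 'I_n -> int).
Hypotheses (n_gt0 : (0 < n)%N) (nu01 : forall k, 0 <= nu k <= 1).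
Hypothesis nu_sum : \sum_k nu k = m%:Z.

(** The difference of [nu] and the slope [m / n], multiplied by [n] to stay integral. *)
Definition weight (k : 'I_n) : int := n%:Z * nu k - m%:Z.
Hypothesis nu_dom : forall j, psum weight j <= 0.

Lemma weight_mod k l : (n %| weight k - weight l)%Z.
Proof.
rewrite /weight opprB addrA subrK -mulrBr.
exact: dvdz_mulr.
Qed.

Lemma weight_sum : \sum_k weight k = 0.
Proof. by rewrite sumrB -mulr_sumr nu_sum sumr_const card_ord; lia. Qed.

(** * Perturbing a rescaled solution into a generic one *)

Section Orbits.
Variables (p : 'S_n) (z : 'I_n -> int) (L : nat).
Hypotheses (L_gt0 : (0 < L)%N) (z_dec : sdec z).
Hypothesis zp : forall k, z (p k) = z k + L%:Z * weight k.

Lemma fixed_iter t k : z ((p ^+ t)%g k) =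
  z k + L%:Z * (n%:Z * (\sum_(i < t) nu ((p ^+ i)%g k)) - t%:Z * m%:Z).
Proof.
elim: t => [|t IH]; first by rewrite expg0 perm1 big_ord0; lia.
rewrite expgSr permM zp IH big_ord_recr /= /weight intS; ring.
Qed.

(* Two strands of an orbit whose times differ by [t], with [n %| t * m], differ
   by multiples of [L * n]; the quotient moves by steps of size at most 1 and
   has mean 0, so it vanishes somewhere, and the strands coincide. *)
Lemma orbit_period t k : (n %| t * m)%N -> (p ^+ t)%g k = k.
Proof.
case/dvdnP => e te; have teZ : t%:Z * m%:Z = e%:Z * n%:Z by rewrite -!PoszM te.
pose h i : int := \sum_(j < t) nu ((p ^+ (i + j))%g k) - e%:Z.
have zh i : z ((p ^+ (t + i))%g k) = z ((p ^+ i)%g k) + L%:Z * n%:Z * h i.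
  rewrite addnC expgD permM (fixed_iter t) teZ /h.
  have -> : \sum_(j < t) nu ((p ^+ j)%g ((p ^+ i)%g k)) =
            \sum_(j < t) nu ((p ^+ (i + j))%g k).
    by apply: eq_bigr => j _; rewrite expgD permM.
  by ring.
have [i hi] : exists i, h i = 0; last first.
  have := zh i; rewrite hi mulr0 addr0 => /(sdec_inj z_dec).
  by rewrite expgD permM => /perm_inj.
apply/not_existsP => h0; have {}h0 i : h i != 0 by apply/eqP/h0.
have hS i : h i.+1 - h i = nu ((p ^+ (i + t))%g k) - nu ((p ^+ i)%g k).
  pose f j := nu ((p ^+ (i + j))%g k).
  have : \sum_(j < t) f j + f t = f 0%N + \sum_(j < t) f j.+1.
    by rewrite -(big_ord_recr t f) big_ord_recl.
  rewrite /h /f addn0 => E.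
  have -> : \sum_(j < t) nu ((p ^+ (i.+1 + j))%g k) = \sum_(j < t) f j.+1.
    by apply: eq_bigr => j _; rewrite /f addnS addSn.
  by move: E; rewrite /f; lia.
have [h1 h2] : (forall i, h i.+1 <= h i + 1) /\ forall i, - h i.+1 <= - h i + 1.
  by split=> i; have := hS i; have := nu01 ((p ^+ (i + t))%g k);
     have := nu01 ((p ^+ i)%g k); lia.
pose O := #[p]%g; have O0 : (0 < O)%N := order_gt0 p.
(* Over a full cycle of [p] both strands take the same values of [z]. *)
have sum0 : \sum_(i < O) h i = 0.
  have : \sum_(i < O) z ((p ^+ (t + i))%g k) = \sum_(i < O) z ((p ^+ i)%g k).
    elim: (t) => [|t' IH]; first by apply: eq_bigr => i _; rewrite add0n.
    rewrite -IH -(sum_cyclic (f := fun i => z ((p ^+ (t' + i))%g k))).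
      by apply: eq_bigr => i _; rewrite addnS addSn.
    by rewrite expgD expg_order mulg1 addn0.
  under eq_bigr do rewrite zh.
  rewrite big_split /= -mulr_sumr => /(canRL (addKr _)); rewrite addNr => /eqP.
  by rewrite mulf_eq0 => /orP[|/eqP//]; lia.
have neg (g : nat -> int) : (forall i, g i < 0) -> \sum_(i < O) g i < 0.
  move=> g0; case: (O) O0 => // O' _; rewrite big_ord_recl.
  by rewrite ltr_wnDr ?sumr_le0 // => i _; exact/ltW.
have [h00|h00] : h 0%N < 0 \/ - h 0%N < 0 by have := h0 0%N; lia.
  suff : \sum_(i < O) h i < 0 by rewrite sum0 ltxx.
  apply: neg => i.
  exact: (int_sign_nat h1 h0 h00 (leq0n i)).
suff : \sum_(i < O) - h i < 0 by rewrite sumrN sum0 oppr0 ltxx.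
apply: (neg (fun i => - h i)) => i.
apply: (int_sign_nat h2 _ h00 (leq0n i)) => j; by rewrite oppr_eq0.
Qed.

Definition orbit_tag (k : 'I_n) : nat := enum_rank (porbit p k).

(** Scaling by [N] leaves room for the orbit numbers, which are less than [N] and separate orbits
    modulo [M * n]. Within one orbit, congruent values make [n] divide [t * m], and [orbit_period]
    applies. *)
Lemma generic_fixed_point : exists w (M : nat), [/\ (0 < M)%N, sdec w,
  distinct_mod (M * n)%N w & forall k, w (p k) = w k + M%:Z * weight k].
Proof.
pose N := #|{set 'I_n}|.
have tagN k : (orbit_tag k < N)%N by exact: ltn_ord.
have N0 : (0 < N)%N by apply: leq_ltn_trans (tagN (Ordinal n_gt0)).
exists (fun k => N%:Z * z k + (orbit_tag k)%:Z), (N * L)%N; split.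
- by rewrite muln_gt0 N0.
- move=> i j /z_dec zij; have := tagN i; have := tagN j.
  have : N%:Z * (z j + 1) <= N%:Z * z i by apply: ler_wpM2l; lia.
  by rewrite mulrDr mulr1; lia.
- move=> k l /dvdzP[q].
  have -> : q * (N * L * n)%N%:Z = N%:Z * (q * L%:Z * n%:Z) by rewrite !PoszM; ring.
  set Q := q * _ * _; move=> E.
  have [tkl zkl] : orbit_tag k = orbit_tag l /\ z k - z l = Q.
    have := tagN k; have := tagN l; move: E.
    move: (orbit_tag k) (orbit_tag l) => a b E bN aN.
    have E' : N%:Z * (Q - (z k - z l)) = a%:Z - b%:Z by rewrite !mulrBr; lia.
    move: E'; set d := Q - _ => E'.
    have d0 : d = 0.
      have [//|[d0|d0]] : d = 0 \/ 1 <= d \/ d <= -1 by lia.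
        by have := ler_wpM2l (ler0n int N) d0; rewrite natz; lia.
      by have := ler_wpM2l (ler0n int N) d0; rewrite natz; lia.
    by move: E'; rewrite d0 mulr0; lia.
  have /porbitP[t lt] : l \in porbit p k.
    have -> : porbit p k = porbit p l by apply/enum_rank_inj/val_inj.
    exact: porbit_id.
  rewrite lt orbit_period //; move: zkl; rewrite lt fixed_iter /Q.
  set S := \sum_(i < t) _ => zkl.
  have {}zkl : L%:Z * (t%:Z * m%:Z) = L%:Z * ((q + S) * n%:Z).
    by move: zkl; rewrite !mulrBr; lia.
  have /(congr1 absz) : t%:Z * m%:Z = (q + S) * n%:Z.
    by apply: (mulfI _ zkl); lia.
  by rewrite !abszM => ->; rewrite dvdn_mull.
- by move=> k; rewrite /orbit_tag (porbit_perm p 1) zp PoszM mulrDr; ring.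
Qed.

End Orbits.

(** * Rescaling by counting points *)

Section Counting.
Variables (p : 'S_n) (w : 'I_n -> int) (M : nat).
Hypotheses (M_gt0 : (0 < M)%N) (w_dec : sdec w).
Hypothesis w_mod : distinct_mod (M * n)%N w.
Hypothesis wp : forall k, w (p k) = w k + M%:Z * weight k.

(* Up to a constant, the number of points of [w + M n Z] below [v]. *)
Definition count_below (v : int) : int := \sum_j ((v - w j) %/ (M * n)%N)%Z.

Let Q_gt0 : 0 < (M * n)%N%:Z.
Proof. by rewrite ltz_nat muln_gt0 M_gt0. Qed.

Lemma count_below_lt (v e : int) (l : 'I_n) : v < w l + e * (M * n)%N ->
  count_below v < count_below (w l + e * (M * n)%N).
Proof.
move=> vl; rewrite /count_below (bigD1 l) //= [ltRHS](bigD1 l) //=.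
apply: ltr_leD.
  rewrite [X in _ < (X %/ _)%Z]addrAC subrr add0r mulzK ?gt_eqF // ltz_divLR //; lia.
by apply: ler_sum => j _; apply: lez_pdiv2r; [exact: ltW | lia].
Qed.

Lemma count_belowD (v e : int) :
  count_below (v + e * (M * n)%N) = count_below v + n%:Z * e.
Proof.
rewrite /count_below.
have E j : ((v + e * (M * n)%N - w j) %/ (M * n)%N)%Z = e + ((v - w j) %/ (M * n)%N)%Z.
  by rewrite -divzMDl ?gt_eqF //; congr (_ %/ _)%Z; ring.
under eq_bigr do rewrite E.
by rewrite big_split /= sumr_const card_ord -mulr_natl natz addrC.
Qed.

(** By [wp], after reindexing by [p] the translation lowers the [k]-th quotient by [nu k], and these
    add up to [m]. *)
Lemma count_belowB (v : int) : count_below (v - M%:Z * m%:Z) = count_below v - m%:Z.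
Proof.
rewrite /count_below -(sum_permute (fun j => ((v - M%:Z * m%:Z - w j) %/ (M * n)%N)%Z) p).
rewrite -[X in _ = _ - X]nu_sum -sumrB.
apply: eq_bigr => k _.
rewrite -[RHS]addrC -divzMDl ?gt_eqF //; congr (_ %/ _)%Z.
by rewrite wp /weight PoszM; ring.
Qed.

(** Counting turns translation by [M * n] into translation by [n], and by [M * m] into [m], which
    removes the factor [M]. *)
Lemma count_below_step : let x k := count_below (w k) in
  [/\ sdec x, distinct_mod n x & step weight p x x].
Proof.
move=> x; split.
- move=> i j /w_dec; rewrite /x -[w i]addr0 -(mul0r (M * n)%N%:Z).
  exact: count_below_lt.
- move=> k l /dvdzP[q xkl]; apply/eqP/negPn/negP => kl.
  (* [w l] shifted by [e] periods is its first translate above [w k] and lies below the next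
     translate of [w k], so the counts cannot be congruent modulo [n]. *)
  pose e : int := ((w k - w l) %/ (M * n)%N)%Z + 1.
  have e1 : w k < w l + e * (M * n)%N.
    have := ltz_ceil (w k - w l) Q_gt0; rewrite -/e; lia.
  have e2 : w l + e * (M * n)%N < w k + (1 : int) * (M * n)%N.
    have := lez_floor (w k - w l) (lt0r_neq0 Q_gt0).
    have : w l + e * (M * n)%N != w k + (1 : int) * (M * n)%N.
      apply: contra_neq kl => E; apply: w_mod; apply/dvdzP.
      by exists (e - 1); rewrite mulrBl; lia.
    by rewrite /e mulrDl; lia.
  have := count_below_lt e2; have := count_below_lt e1.
  rewrite !count_belowD -/(x k) -/(x l) => h1 h2.
  have {}h1 : q * n%:Z < n%:Z * e by lia.
  have {}h2 : n%:Z * (e - 1) < q * n%:Z by rewrite mulrBr; lia.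
  move: h1 h2; rewrite mulrC !ltr_pM2l ?ltz_nat //; lia.
- move=> k; rewrite /x wp /weight.
  have -> : w k + M%:Z * (n%:Z * nu k - m%:Z) =
     w k + nu k * (M * n)%N - M%:Z * m%:Z by rewrite PoszM; ring.
  by rewrite count_belowB count_belowD addrA.
Qed.

End Counting.

Lemma solution_exists : exists p x,
  [/\ sdec x, distinct_mod n x & step weight p x x].
Proof.
have [p [z [L [L0 zd zp]]]] := scaled_fixed_point weight_mod nu_dom weight_sum.
have [w [M [M0 wd wm wp]]] := generic_fixed_point L0 zd zp.
by exists p, (fun k => count_below w M (w k)); exact: count_below_step.
Qed.

End Untangle.

(** * Contraction of a solution that is not small *)


Section Residues.
Variables (n : nat) (n_gt0 : (0 < n)%N).

Lemma residue_subproof (z : int) : (`|(z %% n)%Z| < n)%N.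
Proof.
have := ltz_pmod z (n_gt0 : 0 < n%:Z); have := modz_ge0 z (lt0r_neq0 (n_gt0 : 0 < n%:Z)).
lia.
Qed.

Definition residue (z : int) : 'I_n := Ordinal (residue_subproof z).

Lemma residueE z : (residue z)%:Z = (z %% n)%Z.
Proof. by rewrite /= gez0_abs // modz_ge0 // lt0r_neq0. Qed.

Lemma residue_divz z : z = (z %/ n)%Z * n%:Z + (residue z)%:Z.
Proof. by rewrite residueE -divz_eq. Qed.

Lemma eq_residue z z' : (residue z == residue z') = (n %| z - z')%Z.
Proof.
by rewrite -eqz_mod_dvd -val_eqE -eqz_nat !residueE.
Qed.

Lemma residue_ord (i : 'I_n) : residue i%:Z = i.
Proof. by apply: val_inj; rewrite /= modz_nat absz_nat modn_small. Qed.

Lemma residueD z e : residue (z + e * n%:Z) = residue z.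
Proof. by apply/eqP; rewrite eq_residue addrAC subrr add0r dvdz_mull. Qed.

Lemma residueS z : residue (z + 1) = cyc n (residue z).
Proof.
apply/val_inj/eqP; rewrite permE -eqz_nat residueE.
have -> : val (ordS (residue z)) = ((residue z).+1 %% n)%N by [].
by rewrite -modz_nat -addn1 PoszD residueE modzDml.
Qed.

Lemma residue_perm (x : 'I_n -> int) : distinct_mod n x ->
  exists e : 'S_n, forall k, e k = residue (x k).
Proof.
move=> dx; have xi : injective (fun k => residue (x k)).
  by move=> k l /eqP; rewrite eq_residue => /dx.
by exists (perm xi) => k; rewrite permE.
Qed.

End Residues.

Section Contraction.
Variables (n m : nat) (nu : 'I_n -> int) (p : 'S_n) (x : 'I_n -> int).
Variable (R : pred int).
Hypotheses (n_gt0 : (0 < n)%N) (x_dec : sdec x) (x_mod : distinct_mod n x).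
Hypothesis x_step : step (weight m nu) p x x.
Hypothesis Rn : forall z e : int, R (z + e * n%:Z) = R z.
Hypothesis Rm : forall z : int, R (z - m%:Z) = R z.
Hypothesis R_disj : forall z, R z -> ~~ R (z - 1).
Hypothesis R_gap : forall k l, R (x k) -> (n %| x l - x k - 1)%Z -> x k + 1 < x l.

(** For [R] without consecutive members, this exchanges [z] and [z + 1] whenever [R z]. *)
Definition swap (z : int) : int := z + (R z)%:Z - (R (z - 1))%:Z.

Lemma swapK : involutive swap.
Proof.
move=> z; rewrite /swap; have := @R_disj z; have := @R_disj (z + 1).
have := @R_disj (z - 1).
rewrite addrK; case E : (R z); case F : (R (z - 1)) => //= h1 h2 h3.
- by have := h3 isT.
- rewrite subr0 addrK E; case G : (R (z + 1)); last by rewrite addr0 addrK.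
  by have := h2 G.
- by rewrite addr0 F (negbTE (h1 isT)) subr0 subrK.
- by rewrite addr0 !subr0 E F addr0 subr0.
Qed.

Lemma swapD (z e : int) : swap (z + e * n%:Z) = swap z + e * n%:Z.
Proof. by rewrite /swap [_ + _ - 1]addrAC !Rn; ring. Qed.

(** An entry in [R] moves up by 1 and its partner in the next residue class down by 1; by [R_gap]
    they approach each other, which lowers the sum of squares. *)
Lemma contraction : let y k := swap (x k) in
  [/\ sdec y, distinct_mod n y, step (weight m nu) p y y &
    (exists k, R (x k)) -> \sum_k y k ^+ 2 < \sum_k x k ^+ 2].
Proof.
move=> y; split.
- move=> i j /x_dec xij; rewrite /y /swap.
  (* Entries move by at most 1, so the order could fail only at distance 1, excluded by [R_gap], or
     at distance 2 with both moving, excluded by [R_disj]. *)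
  have h1 : R (x j) -> x i != x j + 1.
    move=> Rj; have := @R_gap j i Rj; case: eqP => // -> h.
    move: h; rewrite ltxx; have -> : x j + 1 - x j - 1 = 0 by lia.
    by rewrite dvdz0 => /(_ isT).
  have h2 : R (x i - 1) -> x i != x j + 1.
    by case: eqP h1 => // -> h; rewrite addrK => /h.
  have h3 : R (x j) -> R (x i - 1) -> x i != x j + 2%:Z.
    move=> Rj; case: eqP => // -> Ri; have := R_disj Ri.
    have -> : x j + 2%:Z - 1 - 1 = x j by lia.
    by rewrite Rj.
  move: h1 h2 h3; case: (R (x j)); case: (R (x i - 1)); case: (R (x i));
    case: (R (x j - 1)) => /= h1 h2 h3;
    try have {}h1 := h1 isT; try have {}h2 := h2 isT; try have {}h3 := h3 isT isT; lia.
- move=> k l /dvdzP[q e]; apply: x_mod; apply/dvdzP; exists q.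
  have : y k = y l + q * n%:Z by lia.
  rewrite /y -swapD => /(can_inj swapK) ->; lia.
- move=> k; rewrite /y x_step /weight.
  have -> : x k + (n%:Z * nu k - m%:Z) = x k + nu k * n%:Z - m%:Z by ring.
  by rewrite /swap Rm [_ - m%:Z - 1]addrAC Rm [_ + _ - 1]addrAC !Rn; ring.
- case=> k0 Rk0; have [e eE] := residue_perm n_gt0 x_mod.
  (* [r k] is the index whose entry is congruent to [x k + 1]; reindexing by [r] pairs upward with
     downward moves. *)
  pose r := (e * cyc n * e^-1)%g.
  have rE k : (n %| x (r k) - x k - 1)%Z.
    rewrite -addrA -opprD -(eq_residue n_gt0) residueS -!eE /r !permM.
    by rewrite permKV.
  have Rr k : R (x (r k) - 1) = R (x k).
    have /dvdzP[q qE] := rE k.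
    by rewrite -(Rn (x k) q); congr (R _); lia.
  have E k : y k ^+ 2 = x k ^+ 2 + ((R (x k))%:Z * (2%:Z * x k + 1) +
      (R (x k - 1))%:Z * (1 - 2%:Z * x k)).
    rewrite /y /swap; have := @R_disj (x k).
    by case: (R (x k)); case: (R (x k - 1)) => /= h; first [by have := h isT | ring].
  under eq_bigr do rewrite E.
  rewrite big_split /= gtrDl big_split /=.
  rewrite -(sum_permute (fun k => (R (x k - 1))%:Z * (1 - 2%:Z * x k)) r) -big_split /=.
  have F k : R (x k) -> (R (x k))%:Z * (2%:Z * x k + 1) +
      (R (x (r k) - 1))%:Z * (1 - 2%:Z * x (r k)) < 0.
    by move=> Rk; have := R_gap Rk (rE k); rewrite Rr Rk /=; lia.
  rewrite (bigD1 k0) //= ltr_nwDl ?F //; apply: sumr_le0 => k _.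
  case Rk : (R (x k)); last by rewrite Rr Rk !mul0r.
  by have := F _ Rk; rewrite Rk => /ltW.
Qed.

End Contraction.

(** * Cocharacters as sorted sets of integers *)


Section Coordinates.
Variables (n : nat) (n_gt1 : (1 < n)%N).
Implicit Types l : cochar n.

Let n_gt0 : (0 < n)%N := ltnW n_gt1.
Local Notation res := (residue n_gt0).

Definition level l (i : 'I_n) : int := i%:Z + n%:Z * l i.

(** The index is the last digit in base [n], so the tie-breaking of [before] becomes the order of
    integers. *)
Lemma beforeE l i j : before l i j = (level l j < level l i).
Proof.
rewrite /before /level; have := ltn_ord i; have := ltn_ord j.
have nz : 0 < n%:Z by rewrite ltz_nat.
case: (ltgtP (l i) (l j)) => [ij|ji|->] jn ijn /=; last by rewrite ltrD2r ltz_nat.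
  have ij' : l i + 1 <= l j by lia.
  by have := ler_wpM2l (ltW nz) ij'; rewrite mulrDr; lia.
have ji' : l j + 1 <= l i by lia.
by have := ler_wpM2l (ltW nz) ji'; rewrite mulrDr; lia.
Qed.

Lemma epsilonE l (e : 'S_n) :
  (forall i j : 'I_n, (level l (e j) < level l (e i)) = (i < j)%N) ->
  epsilon l = e.
Proof.
move=> h; apply: is_epsilon_unique (epsilonP l) _; apply/is_epsilonP => i j.
by rewrite beforeE h.
Qed.

Definition sorted_level l (k : 'I_n) := level l (epsilon l k).

Lemma sorted_level_dec l : sdec (sorted_level l).
Proof. by move=> i j ij; have /is_epsilonP/(_ i j) := epsilonP l; rewrite beforeE ij. Qed.

Lemma residue_level l i : res (level l i) = i.
Proof. by rewrite /level mulrC residueD residue_ord. Qed.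

Lemma residueDn z k : res (z + k%:Z) = (cyc n ^+ k)%g (res z).
Proof.
elim: k => [|k IH]; first by rewrite addr0 expg0 perm1.
by rewrite intS addrCA addrC residueS IH expgSr permM.
Qed.

Lemma cycE (i : 'I_n) : (i.+1 < n)%N /\ cyc n i = i.+1 :> nat \/
  i.+1 = n /\ cyc n i = 0%N :> nat.
Proof.
rewrite permE /=; have := ltn_ord i; rewrite leq_eqVlt => /orP[/eqP e|h].
  by right; rewrite e modnn.
by left; rewrite modn_small.
Qed.

(** When the index wraps around to 0, the translation part of [tau] supplies the missing [n]. *)
Lemma level_tau l i : level (iw_act (tau n) l) (cyc n i) = level l i + 1.
Proof.
rewrite /level !ffunE permK; case: (cycE i) => [[_ ->]|[h ->]] /=.
  by rewrite addr0; lia.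
by rewrite mulrDr mulr1; lia.
Qed.

Lemma level_tauX l i k :
  level (iw_act (tau n ^+ k)%g l) ((cyc n ^+ k)%g i) = level l i + k%:Z.
Proof.
elim: k => [|k IH].
  by rewrite !expg0 perm1 addr0 /iw_act perm_act1 addr0.
by rewrite expgS iw_actM expgSr permM level_tau IH intS addrAC addrA.
Qed.

Lemma level_natural m l i : level l (((cyc n ^+ m)^-1)%g i) =
  level l i + (n%:Z * natural m l i - m%:Z).
Proof.
have := level_tauX l (((cyc n ^+ m)^-1)%g i) m.
have -> : natural m l i = iw_act (tau n ^+ m)%g l i - l i.
  by rewrite /natural /b_tau; set A := iw_act _ _; rewrite !ffunE.
by rewrite permKV mulrBr /level; lia.
Qed.

Definition sorted_step m l : 'S_n := (epsilon l * (cyc n ^+ m)^-1 * (epsilon l)^-1)%g.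

Lemma flatE m l k : flat m l k = natural m l (epsilon l k).
Proof. by rewrite ffunE invgK. Qed.

Lemma sorted_level_step m l :
  step (weight m (flat m l)) (sorted_step m l) (sorted_level l) (sorted_level l).
Proof.
move=> k; rewrite /sorted_level /sorted_step !permM permKV level_natural.
by rewrite /weight flatE.
Qed.

(** The residues of [x] modulo [n] give [epsilon l], the quotients give [l]. *)
Lemma sorted_level_surj m (nu : cochar n) p x : sdec x -> distinct_mod n x ->
  step (weight m nu) p x x ->
  exists l, sorted_level l = x /\ flat m l = nu.
Proof.
move=> xd xm st; have [e eE] := residue_perm n_gt0 xm.
pose l : cochar n := [ffun i => (x ((e^-1)%g i) %/ n)%Z].
have cl k : level l (e k) = x k.
  by rewrite /level ffunE permK eE residueE addrC mulrC -divz_eq.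
have el : epsilon l = e.
  by apply: epsilonE => i j; rewrite !cl sdec_lt.
exists l; split; first by apply: funext => k; rewrite /sorted_level el cl.
apply/ffunP => k; rewrite flatE el.
have := level_natural m l (e k).
have -> : ((cyc n ^+ m)^-1)%g (e k) = e (p k).
  apply: (canLR (permK _)); rewrite !eE -residueDn st /weight.
  have -> : x k + (n%:Z * nu k - m%:Z) + m%:Z = x k + nu k * n%:Z by ring.
  by rewrite residueD.
rewrite !cl st /weight => /addrI/addIr/mulfI -> //.
by rewrite eqz_nat -lt0n.
Qed.

(** The number of steps of length [n] from [z] to the level congruent to [z]. *)
Definition height l (z : int) : int := l (res z) - (z %/ n)%Z.

Lemma heightE l z : n%:Z * height l z = level l (res z) - z.
Proof.
have := residue_divz n_gt0 z; rewrite /level /height mulrBr.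
by set q := (z %/ _)%Z; lia.
Qed.

Lemma nz_inj : injective (fun z : int => n%:Z * z).
Proof. by apply: mulfI; rewrite eqz_nat -lt0n. Qed.

Lemma height_period l z : height l (z + n%:Z) = height l z - 1.
Proof.
apply: nz_inj; rewrite /= heightE mulrBr heightE mulr1.
by have := residueD n_gt0 z 1; rewrite mul1r => ->; lia.
Qed.

(** The 1 subtracted for a positive root is the jump of the quotient when [z + 1] is a multiple of
    [n]. *)
Lemma root_val_height l z :
  root_val l (res (z + 1), res z) = height l (z + 1) - height l z.
Proof.
apply: nz_inj; rewrite /= [RHS]mulrBr !heightE residueS.
rewrite /root_val /pairing inE /level; move: (res z) => i /=.
by case: (cycE i) => [[h ->]|[h ->]]; case: ifP => ?; rewrite !mulrBr ?mulr1; lia.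
Qed.

(** Roots in [Pi] are pairs of consecutive residues, and [cyc n ^+ m] acts as translation by [m]. *)
Lemma smallP m l : small m l <->
  forall r, exists k : nat,
    height l (r + 1 + (k * m)%N%:Z) <= height l (r + (k * m)%N%:Z).
Proof.
have root r k : root_act ((cyc n ^+ m) ^+ k)%g (res (r + 1), res r) =
    (res (r + (k * m)%N%:Z + 1), res (r + (k * m)%N%:Z)).
  by rewrite /root_act /= addrAC !residueDn -expgM mulnC.
split=> [h r|h [p q]].
  have [|k] := h (res (r + 1), res r).
    rewrite residueS; move: (res r) => i; rewrite !inE -val_eqE /=.
    by case: (cycE i) => [[h1 ->]|[h1 ->]]; lia.
  by rewrite root root_val_height subr_le0 addrAC => hk; exists k.
rewrite !inE /= => /andP[_ pq].
have [k hk] := h q%:Z; exists k.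
have -> : (p, q) = (res (q%:Z + 1), res q%:Z).
  congr pair; last by rewrite residue_ord.
  apply: val_inj; rewrite residueS residue_ord /=; have := ltn_ord p.
  by case: (cycE q) pq => [[h1 ->]|[h1 ->]] /=; lia.
by rewrite root root_val_height subr_le0 addrAC.
Qed.

End Coordinates.

(** * Injectivity *)


Section Inversions.
Variables (n m : nat) (a f : int -> int).
Hypotheses (n_gt0 : (0 < n)%N) (a_n : forall z, a (z + n%:Z) = a z - 1).
Hypothesis a_m : forall z, 0 <= a z - a (z + m%:Z) <= 1.
Hypothesis a_small : forall r,
  exists k : nat, a (r + 1 + (k * m)%N%:Z) <= a (r + (k * m)%N%:Z).
Hypothesis f_m : forall z, f (z + m%:Z) = f z + m%:Z.
Hypothesis f_a : forall r s, r < s -> f s < f r -> a r != a s.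

Lemma commute_iter z j : f (z + (j * m)%N%:Z) = f z + (j * m)%N%:Z.
Proof.
elim: j => [|j IH]; first by rewrite mul0n !addr0.
by rewrite mulSn PoszD addrCA addrC f_m IH; lia.
Qed.

(** Along translates by [m] the height difference never vanishes and rises by at most 1 per step, so
    it stays negative. *)
Lemma inversion_sign r s k : r < s -> f s < f r ->
  a (s + (k * m)%N%:Z) < a (r + (k * m)%N%:Z) ->
  forall i : nat, a (s + (i * m)%N%:Z) < a (r + (i * m)%N%:Z).
Proof.
move=> rs fsr hk i.
have an z j : a (z + (j * n)%N%:Z) = a z - j%:Z.
  elim: j => [|j IH]; first by rewrite mul0n !addr0.
  by rewrite mulSn PoszD addrCA addrC a_n IH; lia.
pose h j := a (s + (j * m)%N%:Z) - a (r + (j * m)%N%:Z).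
have h1 j : h j.+1 <= h j + 1.
  have E z : z + (j.+1 * m)%N%:Z = z + (j * m)%N%:Z + m%:Z by lia.
  rewrite /h !E; have := a_m (s + (j * m)%N%:Z); have := a_m (r + (j * m)%N%:Z); lia.
have h0 j : h j != 0.
  by rewrite /h subr_eq0 eq_sym; apply: f_a; rewrite ?commute_iter; lia.
(* The sign only propagates forward; periodicity replaces [i] by an index not less than [k]. *)
have hper : h (i + n * k)%N = h i.
  have E z : z + ((i + n * k) * m)%N%:Z = z + (i * m)%N%:Z + (k * m * n)%N%:Z by lia.
  by rewrite /h !E !an; lia.
have := int_sign_nat h1 h0 (k := k) _ (i := (i + n * k)%N).
rewrite hper /h => H; rewrite -subr_lt0; apply: H; first by rewrite subr_lt0.
by nia.
Qed.

(** Induction on [s - r]: smallness compares heights at one adjacent pair in between, shorter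
    inversions handle both sides, and the sign spreads to all translates. *)
Lemma inversion_lt r s : r < s -> f s < f r ->
  forall k : nat, a (s + (k * m)%N%:Z) < a (r + (k * m)%N%:Z).
Proof.
move: {2}`|s - r|%N (leqnn `|s - r|%N) => N.
elim: N r s => [|N IH] r s hN rs fsr; first by lia.
(* Scanning up from [r] while [f] stays below [f r], stop just before it returns or [s] is reached:
   [r, t] and [t + 1, s] are then inversions or trivial pairs. *)
have [t [rt ts tr st]] : exists t, [/\ r <= t, t < s, t = r \/ f t < f r &
    t + 1 = s \/ f r <= f (t + 1)].
  suff H (j : nat) t : r <= t -> t < s -> t = r \/ f t < f r -> s - t <= j%:Z ->
      exists t, [/\ r <= t, t < s, t = r \/ f t < f r & t + 1 = s \/ f r <= f (t + 1)].
    by apply: (H `|s - r|%N r) => //; [left | lia].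
  elim: j t => [|j IHj] t h1 h2 h3 h4; first by lia.
  have [e|ne] := eqVneq (t + 1) s; first by exists t; split=> //; left.
  have [le|lt] := lerP (f r) (f (t + 1)); first by exists t; split=> //; right.
  by apply: (IHj (t + 1)); [lia | lia | right | lia].
have [k tk] := a_small t.
apply: (inversion_sign (k := k) rs fsr).
have tr' : a (t + (k * m)%N%:Z) <= a (r + (k * m)%N%:Z).
  case: tr => [-> //|ftr]; have [->//|ne] := eqVneq t r.
  by apply/ltW/IH => //; lia.
have st' : a (s + (k * m)%N%:Z) <= a (t + 1 + (k * m)%N%:Z).
  case: st => [-> //|ft]; have [->//|ne] := eqVneq (t + 1) s.
  by apply/ltW/IH => //; lia.
rewrite lt_neqAle (le_trans st' (le_trans tk tr')) andbT eq_sym.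
by apply: f_a; rewrite ?commute_iter; lia.
Qed.

End Inversions.

Section Injectivity.
Variables (n m : nat) (n_gt1 : (1 < n)%N).
Implicit Types l : cochar n.

Let n_gt0 : (0 < n)%N := ltnW n_gt1.
Local Notation res := (residue n_gt0).
Local Notation height := (height n_gt1).

Definition rank l (z : int) : 'I_n := ((epsilon l)^-1)%g (res z).

Lemma level_rank l z : level l (res z) = sorted_level l (rank l z).
Proof. by rewrite /sorted_level permKV. Qed.

Lemma height_rank l z : n%:Z * height l z = sorted_level l (rank l z) - z.
Proof. by rewrite heightE level_rank. Qed.

Lemma height_step l z : height l z - height l (z + m%:Z) = natural m l (res (z + m%:Z)).
Proof.
apply: (nz_inj n_gt1); rewrite /= mulrBr !heightE.
have := level_natural n_gt1 m l (res (z + m%:Z)).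
by rewrite residueDn // permK => ->; lia.
Qed.

(** Sends the [k]-th sorted level of [l] to that of [l'], compatibly with translation by [n]. *)
Definition reindex l l' (z : int) : int :=
  z + sorted_level l' (rank l z) - sorted_level l (rank l z).

Lemma rank_reindex l l' z : rank l' (reindex l l' z) = rank l z.
Proof.
rewrite {1}/rank; apply: (canLR (permK _)).
rewrite -[RHS](residue_level n_gt1 l') -/(sorted_level l' _).
apply/eqP; rewrite eq_residue /reindex.
have : res (sorted_level l (rank l z)) == res z.
  by rewrite -level_rank residue_level.
rewrite eq_residue => /dvdzP[q e]; apply/dvdzP; exists (- q); lia.
Qed.

Lemma reindexK l l' : cancel (reindex l l') (reindex l' l).
Proof. by move=> z; rewrite {1}/reindex rank_reindex /reindex; lia. Qed.

Lemma height_reindex l l' z : height l' (reindex l l' z) = height l z.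
Proof.
by apply: (nz_inj n_gt1); rewrite /= !height_rank rank_reindex /reindex; lia.
Qed.

(** At equal heights [s - r] is a difference of sorted levels of [l], and [l'] orders the same ranks
    in the same way. *)
Lemma reindex_height_neq l l' r s : r < s -> reindex l l' s < reindex l l' r ->
  height l r != height l s.
Proof.
move=> rs fsr; apply/eqP => /(congr1 (fun z => n%:Z * z)); rewrite !height_rank => E.
have : sorted_level l (rank l r) < sorted_level l (rank l s) by lia.
rewrite sdec_lt; last exact: sorted_level_dec.
move=> /(@sorted_level_dec n n_gt1 l' _ _); move: fsr; rewrite /reindex; lia.
Qed.

Lemma reindexD l l' : sorted_step m l = sorted_step m l' -> flat m l = flat m l' ->
  forall z, reindex l l' (z + m%:Z) = reindex l l' z + m%:Z.
Proof.
move=> E F z; rewrite /reindex; set k := rank l (z + m%:Z).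
have -> : rank l z = sorted_step m l k.
  by rewrite /sorted_step !permM permKV residueDn // permK.
rewrite {1}E !sorted_level_step // F; lia.
Qed.

Lemma reindexDn l l' z : reindex l l' (z + n%:Z) = reindex l l' z + n%:Z.
Proof.
rewrite /reindex /rank; have := residueD n_gt0 z 1; rewrite mul1r => ->; lia.
Qed.

(** Both sorted sequences are fixed by their steps, so their distance is kept. *)
Lemma sorted_step_eq l l' : flat m l = flat m l' -> sorted_step m l = sorted_step m l'.
Proof.
move=> F; have st := sorted_level_step n_gt1 m l.
have := sorted_level_step n_gt1 m l'; rewrite -F => st'.
by apply: (step_dist_eq st st') => //; exact: sorted_level_dec.
Qed.

Lemma level_inj l l' : (forall i, level l i = level l' i) -> l = l'.
Proof.
move=> E; apply/ffunP => i; apply: (nz_inj n_gt1).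
by have := E i; rewrite /level => /addrI.
Qed.

Lemma shift_tau l l' (c : nat) :
  (forall k, sorted_level l' k = sorted_level l k + c%:Z) ->
  l' = iw_act (tau n ^+ c)%g l.
Proof.
move=> E; apply: level_inj => i; rewrite -[i](permKV (epsilon l')).
set k := _ i; rewrite -/(sorted_level l' k) E -(level_tauX n_gt1).
congr level; rewrite -[in RHS](residue_level n_gt1 l' (epsilon l' k)).
by rewrite -/(sorted_level l' k) E residueDn // residue_level.
Qed.


(** The map carries its inversions to inversions of its inverse with the same heights, where
    smallness of [l] and of [l'] give opposite strict inequalities. *)
Lemma no_inversion l l' : (forall i, 0 <= natural m l i <= 1) ->
  (forall i, 0 <= natural m l' i <= 1) -> small m l -> small m l' ->
  flat m l = flat m l' ->
  forall r s, r < s -> reindex l l' r <= reindex l l' s.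
Proof.
move=> b b' sl sl' F r s rs; rewrite leNgt; apply/negP => fsr.
have H l1 l2 : (forall i, 0 <= natural m l1 i <= 1) -> small m l1 ->
    flat m l1 = flat m l2 -> forall r s, r < s ->
    reindex l1 l2 s < reindex l1 l2 r -> height l1 s < height l1 r.
  move=> b1 s1 F1 r1 s2 rs1 fs1.
  have /(smallP n_gt1) sm := s1.
  have := @inversion_lt n m (height l1) (reindex l1 l2) n_gt0
   (height_period n_gt1 l1) _ sm (reindexD (sorted_step_eq F1) F1)
   (@reindex_height_neq l1 l2) r1 s2 rs1 fs1 0%N.
  by rewrite mul0n !addr0; apply=> z; rewrite height_step.
have h1 := H _ _ b sl F _ _ rs fsr.
have := H l' l b' sl' (esym F) _ _ fsr; rewrite !reindexK => /(_ rs).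
by rewrite !height_reindex ltNge ltW.
Qed.

Lemma flat_inj_Omega l l' : (forall i, 0 <= natural m l i <= 1) ->
  (forall i, 0 <= natural m l' i <= 1) -> small m l -> small m l' ->
  flat m l = flat m l' -> exists2 w, Omega n w & l' = iw_act w l.
Proof.
move=> b b' sl sl' F; pose f := reindex l l'.
have f_lt z : f z + 1 <= f (z + 1).
  have : f z <= f (z + 1) by apply: no_inversion => //; lia.
  have : f z <> f (z + 1) by move/(can_inj (reindexK l l')); lia.
  by lia.
have f_ge z (k : nat) : f z + k%:Z <= f (z + k%:Z).
  elim: k => [|k IH]; first by rewrite !addr0.
  have -> : z + k.+1%:Z = z + k%:Z + 1 by lia.
  have := f_lt (z + k%:Z); lia.
(* The [n] increments over a period are at least 1 and add up to [n]. *)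
have fS z : f (z + 1) = f z + 1.
  have := f_lt z; have := f_ge (z + 1) n.-1.
  have -> : z + 1 + n.-1%:Z = z + n%:Z by lia.
  have := reindexDn l l' z; rewrite -/f; have -> : n.-1%:Z = n%:Z - 1 by lia.
  by move: (f (z + 1)) (f z) (f _) => A B C -> ; lia.
have fk (k : nat) : f k%:Z = f 0 + k%:Z.
  by elim: k => [|k IH]; rewrite ?addr0 // intS addrC fS IH; lia.
have E k : sorted_level l' k = sorted_level l k + f 0.
  have := fk (epsilon l k); rewrite /f {1}/reindex /rank residue_ord permK; lia.
have [c0|c0] := lerP 0 (f 0).
  exists (tau n ^+ `|f 0|%N)%g; first by exists `|f 0|%N; left.
  by apply: shift_tau => k; rewrite E gez0_abs.
exists (tau n ^- `|f 0|%N)%g; first by exists `|f 0|%N; right.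
rewrite [in RHS](@shift_tau l' l `|f 0|%N) => [|k]; last by rewrite E ltz0_abs // addrK.
rewrite -iw_actM mulVg /iw_act perm_act1.
by apply/ffunP => i; rewrite !ffunE addr0.
Qed.

End Injectivity.

(** * Dominance *)


Section Dominance.
Variables (n m : nat) (n_gt0 : (0 < n)%N) (nu : cochar n).
Hypothesis nu_sum : \sum_i nu i = m%:Z.

Let n_neq0 : n%:R != 0 :> rat.
Proof. by rewrite pnatr_eq0 -lt0n. Qed.

Definition slope_gap (j : nat) : rat :=
  \sum_(i < n | (i < j)%N) (nu_b n m i - cochar_rat nu i).

Lemma psum_slope_gap j : (psum (weight m nu) j)%:~R = - (n%:R * slope_gap j).
Proof.
rewrite /psum /slope_gap mulr_sumr -sumrN rmorph_sum; apply: eq_bigr => i _ /=.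
rewrite !ffunE /weight mulrBr mulrCA divff // mulr1 opprB.
by rewrite rmorphB rmorphM.
Qed.

Lemma psum_le0 j : (psum (weight m nu) j <= 0) = (0 <= slope_gap j).
Proof.
by rewrite -(lerz0 rat) psum_slope_gap oppr_le0 pmulr_rge0 // ltr0n.
Qed.

(** Partial sums of a positive coroot are 0 or 1; conversely, the gaps are the coefficients on
    simple coroots. *)
Lemma dom_leP : dom_le (cochar_rat nu) (nu_b n m) <->
  forall j, psum (weight m nu) j <= 0.
Proof.
split=> [[q q0 qE] j|h].
  rewrite psum_le0 /slope_gap; under eq_bigr do rewrite qE.
  rewrite exchange_big /=; apply: sumr_ge0 => a aP.
  rewrite -mulr_sumr mulr_ge0 ?q0 //.
  have ind (b : 'I_n) : \sum_(i < n | (i < j)%N) (i == b)%:R = (b < j)%N%:R :> rat.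
    rewrite big_mkcond (bigD1 b) //= eqxx big1 ?addr0 => [|i /negbTE ->].
      by case: ifP.
    by case: ifP.
  under eq_bigr do rewrite ffunE.
  rewrite sumrB !ind subr_ge0 ler_nat; move: aP; rewrite inE.
  by case: (ltnP a.2 j) => // h1 h2; rewrite (ltn_trans h2 h1).
have gap0 : slope_gap 0 = 0 by rewrite /slope_gap big1.
have gapn : slope_gap n = 0.
  have : (psum (weight m nu) n)%:~R = 0 :> rat.
    rewrite /psum; under eq_bigl do rewrite ltn_ord.
    by rewrite (weight_sum n_gt0 nu_sum).
  by rewrite psum_slope_gap => /eqP; rewrite oppr_eq0 mulf_eq0 (negbTE n_neq0) => /eqP.
have gapS (i : 'I_n) : slope_gap i.+1 - slope_gap i = nu_b n m i - cochar_rat nu i.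
  rewrite /slope_gap (bigD1 i) //= -addrA.
  rewrite (eq_bigl (fun k : 'I_n => (k < i)%N)) ?subrr ?addr0 // => k.
  by rewrite ltnS [(k < i)%N]ltn_neqAle andbC.
exists (fun a : 'I_n * 'I_n => (a.2 == a.1.+1 :> nat)%:R * slope_gap a.2) => [a _|i].
  by rewrite mulr_ge0 ?ler0n // -psum_le0.
rewrite -gapS big_mkcond /=.
pose F (a b : 'I_n) : rat := (b == a.+1 :> nat)%:R * slope_gap b.
transitivity (\sum_(a < n) \sum_(b < n) F a b * ((i == a)%:R - (i == b)%:R)); last first.
  rewrite pair_bigA /=; apply: eq_bigr => -[a b] _ /=; rewrite inE ffunE /F /=.
  by case: ltnP => // ba; rewrite (@ltn_eqF b a.+1) ?mul0r // ltnS.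
(* For the last index the sum is empty, in agreement with [gapn]. *)
have E1 : \sum_(a < n) \sum_(b < n) F a b * (i == a)%:R = slope_gap i.+1.
  rewrite (bigD1 i) //= eqxx [X in _ + X]big1 ?addr0 => [|a ai];
    last first.
    by rewrite big1 // => b _; rewrite eq_sym (negbTE ai) mulr0.
  under eq_bigr do rewrite mulr1 /F mulr_natl mulrb.
  rewrite -big_mkcond (big_ord1_eq _ slope_gap) /=; case: ltnP => // ni.
  by have -> : i.+1 = n by apply/eqP; rewrite eqn_leq ltn_ord ni.
have E2 : \sum_(a < n) \sum_(b < n) F a b * (i == b)%:R = slope_gap i.
  rewrite exchange_big /= (bigD1 i) //= eqxx [X in _ + X]big1 ?addr0 => [|a ai];
    last first.
    by rewrite big1 // => b _; rewrite eq_sym (negbTE ai) mulr0.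
  case: (posnP i) => [i0|i_gt0].
    by rewrite i0 gap0 big1 // => a _; rewrite /F i0 mul0r mul0r.
  under eq_bigr do rewrite mulr1 /F mulr_natl mulrb -{1}(prednK i_gt0) eqSS eq_sym.
  rewrite -big_mkcond (big_ord1_eq _ (fun=> slope_gap i)) /= ifT //.
  by rewrite (leq_trans _ (ltn_ord i)) // prednK.
rewrite -E1 -E2 -sumrB; apply: eq_bigr => a _; rewrite -sumrB.
by apply: eq_bigr => b _; rewrite mulrBr.
Qed.

Lemma W0_mu_bounds : W0_orbit (mu n m) nu -> forall i, 0 <= nu i <= 1.
Proof. by case=> w _ <- i; rewrite !ffunE; case: (_ < _)%N. Qed.

End Dominance.

Lemma W0_mu_sum n m (nu : cochar n) : (m <= n)%N -> W0_orbit (mu n m) nu ->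
  \sum_i nu i = m%:Z.
Proof.
move=> mn [w _ <-]; under eq_bigr do rewrite ffunE.
rewrite (sum_permute (mu n m) (w^-1)%g); under eq_bigr do rewrite ffunE.
rewrite -natr_sum -[RHS]natz; congr (_%:R).
rewrite -[RHS](card_ord m) -sum1_card (big_ord_widen n (fun=> 1%N)) //.
by rewrite [RHS]big_mkcond; apply: eq_bigr => i _; case: ltnP.
Qed.

(** * Surjectivity and conclusion *)


Lemma Omega_inv n (w : iwahori_weyl n) : Omega n w -> Omega n w^-1%g.
Proof. by case=> k [->|->]; exists k; [right | left; rewrite invgK]. Qed.

Lemma Omega_tau n (w : iwahori_weyl n) : Omega n w -> Omega n (tau n * w)%g.
Proof.
case=> k [->|->]; first by exists k.+1; left; rewrite expgS.
case: k => [|k]; first by exists 1%N; left; rewrite expg0 invg1 mulg1.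
by exists k; right; rewrite expgSr invMg mulKVg.
Qed.

Lemma Omega_tauV n (w : iwahori_weyl n) : Omega n w -> Omega n ((tau n)^-1 * w)%g.
Proof.
case=> k [->|->]; last by exists k.+1; right; rewrite expgSr invMg.
case: k => [|k]; first by exists 1%N; right; rewrite expg0 mulg1.
by exists k; left; rewrite expgS mulKg.
Qed.

Lemma Omega_mul n (v w : iwahori_weyl n) : Omega n v -> Omega n w -> Omega n (v * w)%g.
Proof.
move=> [k [->|->]] Ow.
  elim: k => [|k IH]; first by rewrite expg0 mul1g.
  by rewrite expgS -mulgA; exact: Omega_tau.
elim: k => [|k IH]; first by rewrite expg0 invg1 mul1g.
by rewrite expgSr invMg -mulgA; exact: Omega_tauV.
Qed.

(** * Invariance under [Omega] *)

Section FlatOmega.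
Variables (n m : nat) (n_gt1 : (1 < n)%N).
Implicit Types l : cochar n.

(** All levels grow by 1 at rotated indices, so [epsilon] is composed with [cyc n], which commutes
    with [cyc n ^+ m]. *)
Lemma flat_tau l : flat m (iw_act (tau n) l) = flat m l.
Proof.
have E : epsilon (iw_act (tau n) l) = (epsilon l * cyc n)%g.
  apply: (epsilonE n_gt1) => i j; rewrite !permM !(level_tau n_gt1) ltrD2r.
  exact: (sdec_lt (sorted_level_dec n_gt1 l)).
apply/ffunP => k; rewrite !flatE E permM; apply: (nz_inj n_gt1).
have := level_natural n_gt1 m (iw_act (tau n) l) (cyc n (epsilon l k)).
have := level_natural n_gt1 m l (epsilon l k).
have -> : ((cyc n ^+ m)^-1)%g (cyc n (epsilon l k)) =
          cyc n (((cyc n ^+ m)^-1)%g (epsilon l k)).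
  have : commute (cyc n) ((cyc n ^+ m)^-1)%g by apply/commuteV/commuteX.
  by move=> /permP/(_ (epsilon l k)); rewrite !permM.
rewrite !(level_tau n_gt1); lia.
Qed.

Lemma flat_Omega w l : Omega n w -> flat m (iw_act w l) = flat m l.
Proof.
have H k l' : flat m (iw_act (tau n ^+ k)%g l') = flat m l'.
  elim: k => [|k IH]; last by rewrite expgS iw_actM flat_tau.
  by rewrite expg0 /iw_act perm_act1; congr flat; apply/ffunP => i; rewrite !ffunE addr0.
case=> k [->|->] //; rewrite -[LHS](H k) -iw_actM mulgV /iw_act perm_act1.
by congr flat; apply/ffunP => i; rewrite !ffunE addr0.
Qed.

Lemma W0_natural l nu : W0_orbit nu (flat m l) <-> W0_orbit nu (natural m l).
Proof.
split=> -[w _ wE].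
  exists (w * epsilon l)%g => //; rewrite perm_actM wE /flat -perm_actM mulVg.
  exact: perm_act1.
by exists (w * (epsilon l)^-1)%g => //; rewrite perm_actM wE.
Qed.

Lemma Omega_orbit_eq w l : Omega n w -> Omega_orbit (iw_act w l) = Omega_orbit l.
Proof.
have orb v l' : Omega n v -> forall u, Omega_orbit (iw_act v l') u -> Omega_orbit l' u.
  move=> Ov u [w' Ow' <-]; exists (w' * v)%g; last by rewrite iw_actM.
  exact: Omega_mul.
move=> Ow; apply/seteqP; split=> u; first exact: orb.
have {1}-> : l = iw_act w^-1%g (iw_act w l).
  rewrite -iw_actM mulVg /iw_act perm_act1.
  by apply/ffunP => i; rewrite !ffunE addr0.
by apply: orb; exact: Omega_inv.
Qed.

End FlatOmega.

(** * Smallness of a solution of minimal norm *)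

Section Surjectivity.
Variables (n m : nat) (n_gt1 : (1 < n)%N) (nu : cochar n).
Hypotheses (nu01 : forall i, 0 <= nu i <= 1) (nu_sum : \sum_i nu i = m%:Z).
Hypothesis nu_dom : forall j, psum (weight m nu) j <= 0.

Let n_gt0 : (0 < n)%N := ltnW n_gt1.
Local Notation res := (residue n_gt0).

Lemma small_solution : exists2 l, small m l & flat m l = nu.
Proof.
pose S p x := [/\ sdec x, distinct_mod n x & step (weight m nu) p x x].
have sq0 (x : 'I_n -> int) : 0 <= \sum_k x k ^+ 2.
  by apply: sumr_ge0 => k _; exact: sqr_ge0.
pose A e := `[< exists p x, S p x /\ \sum_k x k ^+ 2 = e%:Z >].
have exA : exists e, A e.
  have [p [x px]] := solution_exists n_gt0 nu01 nu_sum nu_dom.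
  exists (absz (\sum_k x k ^+ 2)); apply/asboolP; exists p, x; split => //.
  by rewrite gez0_abs.
case: (ex_minnP exA) => e /asboolP[p [x [[xd xm st] xe]]] emin.
have [l [lx lnu]] := sorted_level_surj n_gt1 xd xm st.
exists l => //; apply/(smallP n_gt1) => r; apply: contrapT => /forallNP nsm.
(* If smallness fails at [r], the classes modulo [n] of its translates by multiples of [m] form a
   set to which [contraction] applies. *)
pose R z := `[< exists k : nat, (n %| z - (r + (k * m)%N%:Z))%Z >].
have Rn z f : R (z + f * n%:Z) = R z.
  apply/asboolP/asboolP => -[k /dvdzP[q qE]]; exists k; apply/dvdzP.
    by exists (q - f); rewrite mulrBl -qE; ring.
  by exists (q + f); rewrite mulrDl -qE; ring.
have Rm z : R (z - m%:Z) = R z.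
  apply/asboolP/asboolP => -[k /dvdzP[q qE]].
    by exists k.+1; apply/dvdzP; exists q; rewrite -qE mulSn PoszD; ring.
  (* Modulo [n], [n - 1] further translations by [m] undo one. *)
  exists (k + n.-1)%N; apply/dvdzP; exists (q - m%:Z).
  have : ((k + n.-1) * m + m)%N = (k * m + m * n)%N.
    by have : (m * n = m * n.-1 + m)%N; [rewrite -mulnSr prednK | lia].
  move/(congr1 Posz); rewrite mulrBl -qE !PoszD !PoszM; lia.
have R_gap k j : R (x k) -> (n %| x j - x k - 1)%Z -> x k + 1 < x j.
  case/asboolP=> i ik jk; set z := r + (i * m)%N%:Z in ik.
  have resx k' : level l (res (x k')) = x k'.
    by rewrite -{1}lx /sorted_level residue_level -/(sorted_level l k') lx.
  have h1 := heightE n_gt1 l z; have h2 := heightE n_gt1 l (z + 1).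
  have e1 : res z = res (x k) by apply/esym/eqP; rewrite eq_residue.
  have e2 : res (z + 1) = res (x j).
    apply/esym/eqP; rewrite eq_residue.
    have -> : x j - (z + 1) = (x j - x k - 1) + (x k - z) by ring.
    exact: rpredD.
  move: h1 h2; rewrite e1 e2 !resx => h1 h2.
  have := nsm i; rewrite [r + 1 + _]addrAC -/z => /negP; rewrite -ltNge => h3.
  have h3' : height n_gt1 l z + 1 <= height n_gt1 l (z + 1) by rewrite lezD1.
  have := ler_wpM2l (ler0n int n) h3'; rewrite natz mulrDr mulr1 h1 h2; lia.
have succ k : exists j, (n %| x j - x k - 1)%Z.
  have [f fE] := residue_perm n_gt0 xm; exists ((f^-1)%g (res (x k + 1))).
  rewrite -addrA -opprD -(eq_residue n_gt0) -fE permKV; exact: eqxx.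
(* Two consecutive members would make [R] stable under adding 1, hence everything, and [R_gap] fails
   at the largest entry [x k0]. *)
have R_disj z : R z -> ~~ R (z - 1).
  move=> Rz; apply/negP => Rz1.
  have Rsucc y : R y -> R (y + 1).
    case/asboolP: Rz => k /dvdzP[q qE]; case/asboolP: Rz1 => k' /dvdzP[q' qE'].
    case/asboolP=> j /dvdzP[t tE]; apply/asboolP.
    exists (j + k + n.-1 * k')%N; apply/dvdzP; exists (t + q - q' - (k' * m)%N%:Z).
    have : ((j + k + n.-1 * k') * m + k' * m)%N = (j * m + k * m + k' * m * n)%N.
        by have : (k' * m * n = k' * m * n.-1 + k' * m)%N;
        [rewrite -mulnSr prednK | lia].
    move/(congr1 Posz); rewrite !mulrBl !mulrDl -tE -qE -qE' !PoszD !PoszM; lia.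
  have Rall (j : nat) : R (z + j%:Z).
    by elim: j => [|j IH]; rewrite ?addr0 // intS addrCA addrC; exact: Rsucc.
  pose k0 : 'I_n := Ordinal n_gt0.
  have Rk0 : R (x k0).
    have -> : x k0 = z + (res (x k0 - z))%:Z + ((x k0 - z) %/ n)%Z * n%:Z.
      by have := residue_divz n_gt0 (x k0 - z); lia.
    by rewrite Rn.
  have [j jk] := succ k0; have := R_gap _ _ Rk0 jk.
  have [->|j0] : j = k0 \/ (k0 < j)%N.
    by case: (posnP j) => h; [left; apply: val_inj | right].
  - lia.
  - by have := xd _ _ j0; lia.
have [yd ym ys lt] := contraction n_gt0 xd xm st Rn Rm R_disj R_gap.
have {}lt : \sum_k swap R (x k) ^+ 2 < \sum_k x k ^+ 2.
  apply: lt; exists (rank n_gt1 l r); rewrite -lx -level_rank; apply/asboolP.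
  by exists 0%N; rewrite mul0n addr0 -(eq_residue n_gt0) residue_level.
set y := fun k => swap R (x k) in yd ym ys lt.
have : A (absz (\sum_k y k ^+ 2)).
  by apply/asboolP; exists p, y; split => //; rewrite gez0_abs.
move/emin; rewrite -lez_nat -xe gez0_abs // => h.
by move: lt; rewrite ltNge h.
Qed.

End Surjectivity.

Theorem theorem5p18 (n m : nat) (hm : (0 < m)%N) (hmn : (m < n)%N) :
  exists2 flat_bar : set (cochar n) -> cochar n,
    forall l : cochar n, A_sm n m l -> flat_bar (Omega_orbit l) = flat m l &
    set_bij (Omega_quotient (A_sm n m)) (W0mu_le_nu_b n m) flat_bar.
Proof.
have n_gt1 : (1 < n)%N by exact: leq_ltn_trans hmn.
have n_gt0 := ltnW n_gt1.
have self (l : cochar n) : Omega_orbit l l.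
  exists 1%g; first by exists 0%N; left.
  by rewrite /iw_act perm_act1; apply/ffunP => i; rewrite !ffunE addr0.
(* Sets that are not orbits in the domain get the default 0; on orbits [flat_Omega] gives
   independence of the representative. *)
have /boolp.choice[F FE] (S : set (cochar n)) : exists v, forall l,
    A_sm n m l -> S = Omega_orbit l -> v = flat m l.
  have [[l0 [_ S0]]|none] := EM (exists l, A_sm n m l /\ S = Omega_orbit l).
    exists (flat m l0) => l _ Sl.
    have : Omega_orbit l0 l by rewrite -S0 Sl.
    by case=> w Ow <-; rewrite flat_Omega.
  by exists 0 => l Al Sl; case: none; exists l.
have bounds l : A_sm n m l -> forall i, 0 <= natural m l i <= 1.
  by case=> /W0_mu_bounds.
exists F => [l Al|]; first exact: FE.
split.
- move=> _ [l Al <-]; rewrite (FE _ l) //.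
  have W : W0_orbit (mu n m) (flat m l) by apply/W0_natural; case: Al.
  split=> //; apply/(dom_leP n_gt0 (W0_mu_sum (ltnW hmn) W)) => j.
  (* The weight is a permuted minus a sorted sequence, so [psum_perm_le] yields dominance. *)
  have E : weight m (flat m l) = fun k =>
      sorted_level l (sorted_step m l k) - sorted_level l k.
    by apply: funext => k; rewrite (sorted_level_step n_gt1) addrC addKr.
  by rewrite E; apply: psum_perm_le; apply/sdecW/sorted_level_dec.
- move=> _ _ /set_mem[l Al <-] /set_mem[l' Al' <-].
  rewrite (FE _ l) // (FE _ l') // => E.
  have [w Ow ->] := flat_inj_Omega n_gt1 (bounds _ Al) (bounds _ Al') Al.2 Al'.2 E.
  by rewrite Omega_orbit_eq.
- move=> nu [W D]; have s := W0_mu_sum (ltnW hmn) W.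
  have [l sl lnu] := small_solution n_gt1 (W0_mu_bounds W) s ((dom_leP n_gt0 s).1 D).
  have Al : A_sm n m l by split=> //; apply/W0_natural; rewrite lnu.
  by exists (Omega_orbit l); [exists l | rewrite (FE _ l)].
Qed.
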